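(* For $n\ge4$, the set of atomic preference functions of length $n$ is in bijection with the set of $\Gamma$-diagrams of type $(D_n,n)$ of maximal shape $Q$; in particular the two sets have the same cardinality.
   Context: $W$: Weyl group of type $D_n$, simple reflections $s_1,\dots,s_n$, with $s_is_{i+1}$ ($i\le n-2$) and $s_{n-2}s_n$ of order 3 and other pairs commuting; Bruhat order $<$. $Q$: boxes $(r,c)$, $1\le r\le n-1$ (rows top to bottom), $1\le c\le n-r$; $(r,c)$ labeled $s_{r+c-1}$ if $r+c\le n-1$, and for $r+c=n$ labeled $s_n$ if $n-r$ is odd, $s_{n-1}$ if $n-r$ is even; order = transitive closure of $(r,c)\lessdot(r,c+1)$, $(r,c)\lessdot(r-1,c)$. An $\oplus$-diagram of shape $Q$ is $D:Q\to\{0,+\}$; for a linear extension $b_1,\dots,b_m$ of $Q$, $s_{i_t}:=s_{b_{m+1-t}}$, $t_t=s_{i_t}$ if $D(b_{m+1-t})=0$ and $1$ otherwise, $v_{(0)}=1$, $v_{(k)}=t_1\cdots t_k$; $D$ is a $\Gamma$-diagram if $v_{(k-1)}<v_{(k-1)}s_{i_k}$ for all $k$. A preference function of length $n$ is a word $p_1\cdots p_n$ of positive integers with $\{p_1,\dots,p_n\}=\{1,\dots,k\}$ for some $k$. It is atomic if there is no $j$ with $1\le j<n$ and $r\ge1$ such that the proper prefix $p_1\cdots p_j$ consists exactly of all the occurrences in the whole word of the letters $1,\dots,r$ (i.e. $\{p_1,\dots,p_j\}=\{1,\dots,r\}$ and $p_{j+1},\dots,p_n>r$). *)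

(* Defs.v *)
From HB Require Import structures.
From mathcomp Require Import all_boot all_order all_fingroup cyclic zify.
Set Implicit Arguments.
Unset Strict Implicit.
Unset Printing Implicit Defensive.

Section Bruhat.

Variables (gT : finGroupType) (S : {set gT}).
Local Open Scope group_scope.

Definition has_word (w : gT) (k : nat) : bool :=
  [exists t : k.-tuple gT, all (mem S) t && (w == \prod_(x <- t) x)].

Lemma has_word_ex (w : gT) : w \in <<S>> -> exists k, has_word w k.
Proof.
case/gen_prodgP=> k [c cS ->]; exists k; apply/existsP.
exists [tuple c i | i < k]; apply/andP; split.
  by apply/allP=> _ /mapP[i _ ->]; apply: cS.
by rewrite big_map /= enumT.
Qed.

(* The length of w with respect to the generating set S of <<S>>; the value 0
   outside <<S>> is a dummy. *)
Definition coxeter_length (w : gT) : nat :=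
  if @idP (w \in <<S>>) is ReflectT Sw then ex_minn (has_word_ex Sw) else 0.

Definition reflections : {set gT} := class_support S <<S>>.

Definition bruhat_step : rel gT :=
  [rel u v | (u^-1 * v \in reflections)
             && (coxeter_length u < coxeter_length v)].

(* The strict Bruhat order, as a relation between elements of <<S>>. *)
Definition bruhat_lt : rel gT :=
  [rel u v | (u != v) && connect bruhat_step u v].

End Bruhat.

Section TypeD.

Variable n : nat.
Local Open Scope group_scope.

(* (i, false) stands for e_i and (i, true) for - e_i, where 1 <= i <= n; the
   points (0, _) are fixed by all the permutations considered here. *)
Definition signed : finType := ('I_n.+1 * bool)%type.

Definition unit_vec (i : nat) : signed := (inord i, false).
Definition negv (x : signed) : signed := (x.1, ~~ x.2).

(* For x = unit_vec i and y = unit_vec j (resp. y = negv (unit_vec j)), the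
   orthogonal reflection in the root e_i - e_j (resp. e_i + e_j). *)
Definition root_reflection (x y : signed) : {perm signed} :=
  tperm x y * tperm (negv x) (negv y).

(* Simple roots e_i - e_(i+1) for 1 <= i <= n - 1, and e_(n-1) + e_n for
   i = n. *)
Definition simple (i : nat) : {perm signed} :=
  if i < n then root_reflection (unit_vec i) (unit_vec i.+1)
  else root_reflection (unit_vec n.-1) (negv (unit_vec n)).

Definition simples : {set {perm signed}} := [set simple i.+1 | i : 'I_n].

(* The Weyl group of type D_n, as a group of signed permutations. Products of
   permutations are composed from left to right; inversion identifies this with
   the opposite convention, fixing each simple reflection. *)
Definition weylD : {group {perm signed}} := <<simples>>%G.

Lemma root_reflectionE (x y : signed) : x.1 != y.1 -> forall z,
  root_reflection x y z =
    if z.1 == x.1 then if z == x then y else negv y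
    else if z.1 == y.1 then if z == y then x else negv x else z.
Proof.
case: x y => [i a] [j b] /= ij [k c].
rewrite /root_reflection /negv permM !permE /= !xpair_eqE /=.
have ji : j != i by rewrite eq_sym.
case: (eqVneq k i) => [->|ki]; last case: (eqVneq k j) => [->|kj];
  case: a b c => [] [] [] /=;
  by rewrite ?permE ?(xpair_eqE, eqxx, negPf ij, negPf ji, andbF) //=
             ?(negPf ki, negPf kj, negPf ij, negPf ji).
Qed.

Lemma root_reflection_negv (x y z : signed) : x.1 != y.1 ->
  root_reflection x y (negv z) = negv (root_reflection x y z).
Proof.
move=> xy; rewrite !root_reflectionE //=.
case: x y z xy => [i a] [j b] [k c] /= _; rewrite /negv !xpair_eqE.
by case: (k == i); case: (k == j); case: a b c => [] [] [].
Qed.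

Lemma root_reflectionJ (x y z t : signed) : z.1 != t.1 ->
  root_reflection x y ^ root_reflection z t =
  root_reflection (root_reflection z t x) (root_reflection z t y).
Proof.
by move=> zt; rewrite {1}/root_reflection conjMg !tpermJ !root_reflection_negv.
Qed.

Lemma tperm_negv_commute (x y : signed) : x.1 != y.1 ->
  commute (tperm x y) (tperm (negv x) (negv y)).
Proof.
case: x y => [i a] [j b] /= ij; apply/commgP/conjg_fixP; rewrite tpermJ.
by rewrite !tpermD // xpair_eqE /= ?(negPf ij, eq_sym j i) ?andbF //;
  case: a b => [] []; rewrite ?andbF.
Qed.

Lemma root_reflectionN (x y : signed) : x.1 != y.1 ->
  root_reflection (negv x) (negv y) = root_reflection x y.
Proof.
move=> xy; rewrite /root_reflection (tperm_negv_commute xy).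
by case: x y xy => [i a] [j b] _; rewrite /negv /= !negbK.
Qed.

Lemma root_reflectionC (x y : signed) : root_reflection x y = root_reflection y x.
Proof. by rewrite /root_reflection tpermC (tpermC (negv _)). Qed.

Lemma root_reflection2 (x y : signed) : x.1 != y.1 ->
  root_reflection x y * root_reflection x y = 1.
Proof.
move=> xy; rewrite {1}/root_reflection (tperm_negv_commute xy) -mulgA.
by rewrite /root_reflection (mulgA (tperm x y)) tperm2 mul1g tperm2.
Qed.

Lemma root_reflection_commute (x y z t : signed) : x.1 != y.1 -> z.1 != t.1 ->
    x.1 != z.1 -> x.1 != t.1 -> y.1 != z.1 -> y.1 != t.1 ->
  commute (root_reflection x y) (root_reflection z t).
Proof.
move=> xy zt xz xt yz yt; apply/commgP/conjg_fixP; rewrite root_reflectionJ //.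
by rewrite !root_reflectionE // (negPf xz) (negPf xt) (negPf yz) (negPf yt).
Qed.

Lemma root_reflection_commuteN (x y : signed) : x.1 != y.1 ->
  commute (root_reflection x y) (root_reflection x (negv y)).
Proof.
move=> xy; apply/commgP/conjg_fixP; rewrite root_reflectionJ //=.
have yx : y.1 != x.1 by rewrite eq_sym.
rewrite !root_reflectionE //= eqxx (negPf yx) eqxx eqxx.
have -> : (y == negv y) = false by apply/negP=> /eqP; case: y {xy yx} => k [].
by rewrite root_reflectionN // root_reflectionC.
Qed.

Lemma root_reflection_order3 (x y z : signed) :
    x.1 != y.1 -> y.1 != z.1 -> x.1 != z.1 ->
  #[root_reflection x y * root_reflection y z] = 3.
Proof.
move=> xy yz xz; set a := root_reflection x y; set b := root_reflection y z.
have [yx zy zx] : [/\ y.1 != x.1, z.1 != y.1 & z.1 != x.1].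
  by rewrite ![_.1 == x.1]eq_sym [_ == y.1]eq_sym.
have aV : a^-1 = a by apply/eqP; rewrite eq_invg_mul root_reflection2.
have bV : b^-1 = b by apply/eqP; rewrite eq_invg_mul root_reflection2.
have aJb : b * a * b = root_reflection x z.
  rewrite -{1}bV -mulgA -[_ * _]/(a ^ b) root_reflectionJ // !root_reflectionE //.
  by rewrite (negPf xy) (negPf xz) !eqxx.
have bJa : a * b * a = root_reflection x z.
  rewrite -{1}aV -mulgA -[_ * _]/(b ^ a) root_reflectionJ // !root_reflectionE //.
  by rewrite (negPf yx) (negPf zx) (negPf zy) !eqxx.
have abx : (a * b) x = z by rewrite permM /a /b !root_reflectionE // !eqxx.
clearbody a b; have ab3 : (a * b) ^+ 3 = 1.
  rewrite !expgS expg0 mulg1 !mulgA bJa.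
  by rewrite -(mulgA _ b a) -(mulgA _ _ b) aJb root_reflection2.
have : #[a * b] %| 3 by rewrite order_dvdn ab3.
rewrite dvdn_divisors // !inE order_eq1 => /orP[] /eqP // ab1.
by rewrite -abx ab1 perm1 eqxx in xz.
Qed.

Lemma unit_vec_neq i j : i <= n -> j <= n -> i != j ->
  (unit_vec i).1 != (unit_vec j).1.
Proof. by move=> i_n j_n; rewrite -val_eqE /= !inordK. Qed.

Lemma simple_order3 i : 0 < i -> i.+1 < n -> #[simple i * simple i.+1] = 3.
Proof.
move=> i_gt0 i_n; rewrite /simple i_n (ltnW i_n).
by apply: root_reflection_order3; apply: unit_vec_neq; lia.
Qed.

Lemma simple_order3_last : 3 <= n -> #[simple n.-2 * simple n] = 3.
Proof.
move=> n3; rewrite /simple ltnn ifT; last lia.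
have -> : n.-2.+1 = n.-1 by lia.
by apply: root_reflection_order3; apply: (@unit_vec_neq _ _); lia.
Qed.

Lemma simple_commute i j : 0 < i -> i < j -> j <= n ->
    ~~ ((j == i.+1) && (j < n)) -> ~~ ((i == n.-2) && (j == n)) ->
  commute (simple i) (simple j).
Proof.
move=> i0 ij jn h1 h2; rewrite /simple (leq_trans ij jn).
case: ltnP => [j_n|n_j].
  by apply: root_reflection_commute; apply: (@unit_vec_neq _ _); lia.
case: (eqVneq i n.-1) => [-> | i_n].
  by rewrite prednK; [apply: root_reflection_commuteN; apply: unit_vec_neq|]; lia.
by apply: root_reflection_commute; apply: (@unit_vec_neq _ _); lia.
Qed.

(* The box (r, c), with 1-based r and c, is the pair of ordinals with the values
   r and c. *)
Definition box : finType :=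
  {p : 'I_n * 'I_n | [&& 0 < p.1, 0 < p.2 & p.1 + p.2 <= n]}.

Definition box_row (x : box) : nat := (val x).1.
Definition box_col (x : box) : nat := (val x).2.

Definition label (x : box) : nat :=
  if box_row x + box_col x < n then (box_row x + box_col x).-1
  else if odd (n - box_row x) then n else n.-1.

Lemma label_bounds (x : box) : 1 <= label x <= n.
Proof.
by case: x => -[r c] /= rc; rewrite /label /box_row /box_col /=; do 2?case: ifP; lia.
Qed.

Definition box_cover : rel box :=
  [rel x y | ((box_row y == box_row x) && (box_col y == (box_col x).+1))
             || ((box_row x == (box_row y).+1) && (box_col y == box_col x))].

Definition box_le : rel box := connect box_cover.

Definition linear_extension (b : seq box) : bool :=
  perm_eq b (enum box)
  && [forall x, forall y, box_le x y ==> (index x b <= index y b)].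

Lemma linear_extension_ex : exists b : seq box, linear_extension b.
Proof.
pose h (x : box) := box_col x + (n - box_row x).
have rn (x : box) : box_row x < n by rewrite /box_row ltn_ord.
pose b := sort (relpre h leq) (enum box).
have tr : transitive (relpre h leq) by move=> y x z; apply: leq_trans.
exists b; apply/andP; split; first by rewrite perm_sort.
apply/forallP=> x; apply/forallP=> y; apply/implyP=> /connectP[p].
elim: p x => [|z p IHp] x /= => [_ -> // | /andP[xz zp] yE].
apply: leq_trans (IHp _ zp yE); have hxz : h x < h z.
  move: (rn x) (rn z).
  by case/orP: xz => /andP[/eqP e1 /eqP e2]; rewrite /h ?e1 ?e2; lia.
have inb u : u \in b by rewrite mem_sort mem_enum.
rewrite leqNgt; apply/negP=> zx.
have tot : total (relpre h leq) by move=> u v; apply: leq_total.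
have bS : sorted (relpre h leq) b by apply: sort_sorted.
have := sorted_ltn_index tr bS _ _ (inb z) (inb x) zx.
by rewrite /= leqNgt hxz.
Qed.

(* true stands for +, and false for 0. *)
Definition diagram : finType := {ffun box -> bool}.

Section Gamma.

Variables (b : seq box) (D : diagram).

Definition reading_word : seq {perm signed} :=
  [seq simple (label x) | x <- rev b].

Definition subexpression : seq {perm signed} :=
  [seq if D x then 1 else simple (label x) | x <- rev b].

(* The partial product v_(k). *)
Definition partial_prod (k : nat) : {perm signed} :=
  \prod_(t <- take k subexpression) t.

Lemma partial_prod_weylD (k : nat) : partial_prod k \in weylD.
Proof.
rewrite /partial_prod big_seq; apply: group_prod => t /mem_take/mapP[x _ ->].
case: (D x); rewrite ?group1 // mem_gen //.
have /andP[l_gt0 l_le_n] := label_bounds x.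
have l_lt_n : (label x).-1 < n by rewrite prednK.
by apply/imsetP; exists (Ordinal l_lt_n); rewrite //= prednK.
Qed.

(* The letter in position k.+1 of the reading word is nth 1 reading_word k. *)
Definition is_gamma : bool :=
  [forall k : 'I_(size b),
     bruhat_lt simples (partial_prod k)
                       (partial_prod k * nth 1 reading_word k)].

End Gamma.

Definition gamma_diagram (b : seq box) : finType := {D : diagram | is_gamma b D}.

End TypeD.

(* The set of letters of s is {1, ..., k}. *)
Definition letters_upto (s : seq nat) (k : nat) : bool :=
  all (mem (iota 1 k)) s && all (mem s) (iota 1 k).

Lemma letters_uptoP (s : seq nat) (k : nat) :
  reflect (s =i iota 1 k) (letters_upto s k).
Proof.
apply: (iffP andP) => [[/allP sk /allP ks] x | sk].
  by apply/idP/idP; [apply: sk | apply: ks].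
by split; apply/allP=> x /=; rewrite sk.
Qed.

Lemma letters_upto_size (s : seq nat) (k : nat) : letters_upto s k -> k <= size s.
Proof.
case/andP=> _ /allP ks.
by rewrite -[k in k <= _](size_iota 1); apply: uniq_leq_size; rewrite ?iota_uniq.
Qed.

Section Preference.

Variable n : nat.

(* The bound k <= n loses nothing: see preference_functionP. *)
Definition preference_function (p : n.-tuple nat) : bool :=
  [exists k : 'I_n.+1, letters_upto p k].

Lemma preference_functionP (p : n.-tuple nat) :
  reflect (exists k, p =i iota 1 k) (preference_function p).
Proof.
apply: (iffP existsP) => [[k /letters_uptoP pk] | [k /letters_uptoP pk]].
  by exists k.
have k_le_n : k < n.+1 by rewrite ltnS -(size_tuple p) letters_upto_size.
by exists (Ordinal k_le_n).
Qed.

(* The bound r <= n loses nothing: see atomicP. *)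
Definition atomic (p : n.-tuple nat) : bool :=
  ~~ [exists j : 'I_n, exists r : 'I_n.+1,
        [&& 0 < j, 0 < r, letters_upto (take j p) r & all (ltn r) (drop j p)]].

Lemma atomicP (p : n.-tuple nat) :
  reflect (~ exists j r : nat,
             [/\ 1 <= j < n, 1 <= r, take j p =i iota 1 r
               & {in drop j p, forall x, r < x}])
          (atomic p).
Proof.
apply: (iffP negP) => pA pE; apply: pA.
  case: pE => j [r [/andP[j_gt0 j_lt_n] r_gt0 /letters_uptoP jr /allP rj]].
  have r_le_n : r < n.+1.
    rewrite ltnS (leq_trans (letters_upto_size jr)) // size_take size_tuple.
    by rewrite j_lt_n ltnW.
  apply/existsP; exists (Ordinal j_lt_n); apply/existsP; exists (Ordinal r_le_n).
  by apply/and4P; split.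
case/existsP: pE => j /existsP[r /and4P[j_gt0 r_gt0 /letters_uptoP jr /allP rj]].
by exists j, r; split; rewrite ?j_gt0 ?ltn_ord.
Qed.

Definition atomic_preference_function : Type :=
  {p : n.-tuple nat | preference_function p && atomic p}.

HB.instance Definition _ := Countable.on atomic_preference_function.

Definition pref_bounded (p : atomic_preference_function) : n.-tuple 'I_n.+1 :=
  [tuple of map inord (val p)].

Definition pref_unbounded (t : n.-tuple 'I_n.+1) :
  option atomic_preference_function := insub [tuple of map val t].

Lemma pref_boundedK : pcancel pref_bounded pref_unbounded.
Proof.
move=> p; rewrite /pref_unbounded; set q := [tuple of _].
suff -> : q = val p by rewrite valK.
apply: val_inj; rewrite /= -map_comp; apply: map_id_in => x px /=.
case/andP: (valP p) => /existsP[k /letters_uptoP pk] _.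
rewrite inordK //; move: px; rewrite pk mem_iota add1n => /andP[_ x_le_k].
exact: leq_trans x_le_k (ltn_ord k).
Qed.

HB.instance Definition _ : isFinite atomic_preference_function :=
  PCanIsFinite pref_boundedK.

End Preference.

(* Main.v *)
Require Import Defs.
From HB Require Import structures.
From mathcomp Require Import all_boot all_order all_algebra all_fingroup zify.
Set Implicit Arguments.
Unset Strict Implicit.
Unset Printing Implicit Defensive.

(** Write [u_i] for [v^-1 (e_i)], coding [e_j] by [n - j] and [- e_j] by
    [- (n - j)], so that [e_n] becomes [0]. A Gamma-diagram is determined by
    its last partial product [v]: running the reading word backwards, the
    simple reflection [s] was used exactly when it is a descent of the current
    element. So Gamma-diagrams correspond to the words [u] which are brought to
    [n-1, ..., 1, 0] by greedy sorting along the reading word. Read by rows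
    this is a bubble sort in which every pass ends with a change of sign, and
    looking at it through thresholds one finds that it succeeds iff
    - [- p <= u_p] for every place [p] (counted from [0]), and
    - whenever the first [k] entries have absolute values below [k], with
      [0 < k < n], the number of positive entries after them is even.

    Words of length [n] with the first property are as numerous as preference
    functions: with [m] the number of nonnegative entries, respectively of
    letters, deleting the last entry shows that both are counted by
    [T (n+1) m = m (T n m + T n (m-1))]. Let [F n] be this common number.
    Splitting a preference function at its last cut gives
    [F n = sum_(a < n) F a * A (n - a)] with [A] the number of atomic ones;
    splitting a word at the last [k] violating the second property gives the
    same relation for the number of words with both properties. *)

(** * Words, cuts and convolutions *)

Section Words.
Variables (T : eqType) (A : seq T).

Definition words n : seq (seq T) :=
  iter n (fun L => [seq x :: w | x <- A, w <- L]) [:: [::]].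

Lemma mem_words n w : (w \in words n) = (size w == n) && all (mem A) w.
Proof.
elim: n w => [|n IHn] [|x w] //=.
  by apply/allpairsP => -[[y v] [_ _]].
rewrite eqSS; apply/allpairsP/idP => [[[y v] /= [yA vn [-> ->]]]|].
  by rewrite IHn in vn; rewrite yA.
by case/and3P=> wn xA wA; exists (x, w); rewrite IHn wn wA.
Qed.

Lemma words_uniq n : uniq A -> uniq (words n).
Proof.
move=> uA; elim: n => //= n IHn; apply: allpairs_uniq => //.
by move=> [x w] [y v] _ _ /= [-> ->].
Qed.

End Words.

Lemma sumn_iota (f : nat -> nat) n : sumn [seq f a | a <- iota 0 n] = \sum_(a < n) f a.
Proof. by rewrite sumnE big_map -[n in iota _ n]subn0 big_mkord. Qed.

Section Gluing.

(** [H n] lists the objects of size n, [cut u a] says that [u] may be split at place a, and [suf]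
    and [glue] normalise and reattach the suffix. The section is applied to preference functions and
    to low words. *)
Variables (T : eqType) (H : nat -> seq (seq T)) (cut : seq T -> nat -> bool).
Variables (glue : seq T -> seq T -> seq T) (suf : nat -> seq T -> seq T).

Hypothesis H_uniq : forall n, uniq (H n).
Hypothesis cut0 : forall n u, u \in H n -> cut u 0.
Hypothesis glueP : forall a b h g, h \in H a -> g \in H b -> 0 < b ->
  [/\ glue h g \in H (a + b), take a (glue h g) = h, suf a (glue h g) = g,
      cut (glue h g) a & forall c, 0 < c < b -> cut (glue h g) (a + c) = cut g c].
Hypothesis cutP : forall n a u, u \in H n -> a < n -> cut u a ->
  [/\ take a u \in H a, suf a u \in H (n - a) & glue (take a u) (suf a u) = u].

Definition primitives n : seq (seq T) :=
  [seq u <- H n | all (fun c => ~~ cut u c) (iota 1 n.-1)].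

Lemma mem_primitives n u : 0 < n ->
  (u \in primitives n) -> u \in H n /\ forall c, 0 < c < n -> ~~ cut u c.
Proof.
move=> n0; rewrite mem_filter => /andP[/allP uP uH]; split=> // c cn.
by apply: uP; rewrite mem_iota; lia.
Qed.

(* The largest cut of a word splits off a primitive suffix. *)
Lemma size_gluing n : 0 < n ->
  size (H n) = \sum_(a < n) size (H a) * size (primitives (n - a)).
Proof.
move=> n0.
pose t a := [seq (h, g) | h <- H a, g <- primitives (n - a)].
pose f (a : nat) (p : seq T * seq T) := glue p.1 p.2.
have tP a p : a < n -> p \in t a ->
    [/\ p.1 \in H a, p.2 \in H (n - a) & forall c, 0 < c < n - a -> ~~ cut p.2 c].
  move=> an /allpairsP[[h g] /= [hH gP ->]]; have na : 0 < n - a by lia.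
  by have [gH gc] := mem_primitives na gP.
have fP a p : a < n -> p \in t a ->
    [/\ f a p \in H n, take a (f a p) = p.1, suf a (f a p) = p.2,
        cut (f a p) a & forall c, a < c < n -> ~~ cut (f a p) c].
  move=> an /(tP _ _ an)[p1 p2 pP]; have na : 0 < n - a by lia.
  have [g1 g2 g3 g4 g5] := glueP p1 p2 na; split=> //.
    by rewrite subnKC in g1; last lia.
  move=> c /andP[ac cn]; have -> : c = a + (c - a) by lia.
  by rewrite g5; [apply: pP|]; lia.
have sizet a : size (t a) = size (H a) * size (primitives (n - a)).
  by rewrite size_allpairs.
have /perm_size -> : perm_eq (H n) [seq f a p | a <- iota 0 n, p <- t a].
  apply: uniq_perm => //; first 1 last.
  - move=> u; apply/idP/allpairsPdep => [uH|[a [p [an pt ->]]]]; last first.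
      by rewrite mem_iota in an; have [] := fP a p _ pt; first lia.
    have ex_a : exists a, (a < n) && cut u a by exists 0; rewrite n0 (cut0 uH).
    have a_max a : (a < n) && cut u a -> a <= n by case/andP=> /ltnW.
    (* A last cut exists because 0 is one; a cut inside the suffix after it would give a later cut
       of [u]. *)
    case: (ex_maxnP ex_a a_max) => a /andP[an ua] amax.
    have [v1 v2 v3] := cutP uH an ua.
    exists a, (take a u, suf a u); split=> //; first by rewrite mem_iota.
    apply/allpairsP; exists (take a u, suf a u); split=> //=.
    rewrite mem_filter v2 andbT; apply/allP=> c; rewrite mem_iota => ca.
    have na : 0 < n - a by lia.
    have [_ _ _ _ g5] := glueP v1 v2 na.
    rewrite -g5 ?v3; last lia.
    apply/negP=> uc; have := amax (a + c); rewrite uc; lia.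
  - apply: allpairs_uniq_dep; first exact: iota_uniq.
      move=> a; rewrite mem_iota => an; apply: allpairs_uniq => //.
        exact: filter_uniq.
      by move=> [h g] [h' g'] _ _ [-> ->].
    move=> _ _ /allpairsPdep[a [p [an pt ->]]] /allpairsPdep[a' [p' [an' pt' ->]]] /= e.
    rewrite !mem_iota /= add0n in an an'.
    have [_ e1 e2 ca cga] := fP a p an pt.
    have [_ e1' e2' ca' cga'] := fP a' p' an' pt'.
    (* Both [a] and [a'] are the last cut of the same word. *)
    have [aa'|aa'|aa'] := ltngtP a a'.
    + by have := cga a'; rewrite aa' an' e ca' => /(_ isT).
    + by have := cga' a; rewrite aa' an -e ca => /(_ isT).
    + subst a'; congr (existT _ a _).
      have : (p.1, p.2) = (p'.1, p'.2) by rewrite -e1 -e2 -e1' -e2' e.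
      by rewrite -!surjective_pairing.
rewrite size_allpairs_dep sumn_iota.
by apply: eq_bigr => a _; rewrite sizet.
Qed.

End Gluing.

(** The summand a = 0 is [P n] itself and the others involve [P] only below n, so the relation
    determines [P] recursively from [F]. *)
Lemma convolution_inj (F P P' : nat -> nat) : F 0 = 1 ->
    (forall n, 0 < n -> F n = \sum_(a < n) F a * P (n - a)) ->
    (forall n, 0 < n -> F n = \sum_(a < n) F a * P' (n - a)) ->
  forall n, 0 < n -> P n = P' n.
Proof.
move=> F0 FP FP'; elim/ltn_ind=> -[//|n] IHn _.
have := FP n.+1 isT; rewrite (FP' n.+1 isT) !big_ord_recl /= F0 !mul1n subn0.
rewrite (eq_bigr (fun a : 'I_n => F (bump 0 a) * P (n.+1 - bump 0 a))).
  by move/addIn.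
by move=> a _; congr (_ * _); rewrite IHn //; rewrite /bump; have := ltn_ord a; lia.
Qed.

(** m! times the Stirling number of the second kind: the last point either shares its image with
    another point or is alone over it. For m = 0 the factor m removes the value at the truncated
    [m.-1]. *)
Fixpoint surjections n m : nat :=
  if n is n'.+1 then m * (surjections n' m + surjections n' m.-1) else m == 0.

(** * Preference functions *)

Lemma letters_upto_mem s k : letters_upto s k -> forall x, (x \in s) = (0 < x <= k).
Proof. by move/letters_uptoP=> sk x; rewrite sk mem_iota add1n ltnS. Qed.

Lemma mem_letters_upto s k : (forall x, (x \in s) = (0 < x <= k)) -> letters_upto s k.
Proof. by move=> sk; apply/letters_uptoP=> x; rewrite sk mem_iota add1n ltnS. Qed.

Definition prefs_upto n m : seq (seq nat) :=
  [seq p <- words (iota 1 n) n | letters_upto p m].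

Lemma prefs_upto_uniq n m : uniq (prefs_upto n m).
Proof. by rewrite filter_uniq ?words_uniq ?iota_uniq. Qed.

Lemma mem_prefs_upto n m p :
  (p \in prefs_upto n m) = (size p == n) && letters_upto p m.
Proof.
rewrite mem_filter mem_words andbC -andbA; case: eqP => //= pn.
case pm: (letters_upto p m); rewrite ?andbF // andbT.
apply/allP=> x; rewrite (letters_upto_mem pm) /= mem_iota.
by have := letters_upto_size pm; lia.
Qed.

Lemma letters_upto_rcons_mem q l m : 0 < l <= m -> letters_upto q m ->
  letters_upto (rcons q l) m.
Proof.
move=> lm qm; apply: mem_letters_upto => x.
by rewrite mem_rcons inE (letters_upto_mem qm); case: eqP => // ->; rewrite lm.
Qed.

(** [bump l] opens a gap at l, which the appended letter fills. *)
Lemma letters_upto_rcons_bump q l m : 0 < l <= m.+1 ->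
  letters_upto (rcons (map (bump l) q) l) m.+1 = letters_upto q m.
Proof.
move=> lm; apply/idP/idP => qm; apply: mem_letters_upto => x.
  have := letters_upto_mem qm (bump l x).
  rewrite mem_rcons inE eq_sym (negPf (neq_bump _ _)) /= mem_map; last exact: can_inj (bumpK l).
  by move=> ->; rewrite /bump; case: leqP; lia.
rewrite mem_rcons inE; case: eqVneq => [->|xl] /=; first by rewrite lm.
rewrite -(unbumpK (x := x) (h := l)) ?inE // mem_map; last exact: can_inj (bumpK l).
rewrite (letters_upto_mem qm) /bump /unbump; case: (ltnP l x) => _; case: leqP; lia.
Qed.

(** Delete the last letter l, for which there are m choices. Either l occurs elsewhere and the same
    letters remain, or closing the gap at l leaves m - 1 letters. *)
Lemma size_prefs_upto n m : size (prefs_upto n m) = surjections n m.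
Proof.
elim: n m => [|n IHn] m.
  by case: m.
case: m => [|m]; rewrite [surjections _ _]/=.
  rewrite mul0n; case E: (prefs_upto _ _) => [//|p s].
  have: p \in prefs_upto n.+1 0 by rewrite E mem_head.
  rewrite mem_prefs_upto => /andP[ps pm]; case: p ps pm {E} => [//|x p] _ pm.
  by have := letters_upto_mem pm x; rewrite mem_head; lia.
(* The list of possible last letters is kept abstract, so that simplification does not unfold it. *)
have [L [L_uniq L_size L_mem]] :
    exists L, [/\ uniq L, size L = m.+1 & forall x, (x \in L) = (0 < x <= m.+1)].
  exists (iota 1 m.+1); rewrite iota_uniq size_iota; split=> // x.
  by rewrite mem_iota add1n ltnS.
pose A := [seq rcons q l | q <- prefs_upto n m.+1, l <- L].
pose B := [seq rcons (map (bump l) q) l | q <- prefs_upto n m, l <- L].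
have lB q l : l \in map (bump l) q = false.
  by apply/negbTE/mapP => -[x _ /eqP]; rewrite (negPf (neq_bump _ _)).
have -> : m.+1 * (surjections n m.+1 + surjections n m) = size (A ++ B).
  by rewrite size_cat !size_allpairs L_size !IHn; lia.
apply: perm_size; apply: uniq_perm; first exact: prefs_upto_uniq.
  rewrite cat_uniq !allpairs_uniq ?prefs_upto_uniq  //.
  - rewrite andbT /=; apply/hasPn=> _ /allpairsP[[q l] /= [_ lm ->]].
    apply/negP=> /allpairsP[[q' l'] /= [q'm _ /rcons_inj[qq' ll']]].
    subst l'; have := lB q l; rewrite qq'.
    move: q'm; rewrite mem_prefs_upto => /andP[_ /letters_upto_mem ->].
    by rewrite -L_mem lm.
  - move=> [q l] [q' l'] _ _ /= /rcons_inj[qq' ll']; subst l'.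
    by rewrite (inj_map (can_inj (bumpK l)) qq').
  - by move=> [q l] [q' l'] _ _ /= /rcons_inj[-> ->].
move=> p; rewrite mem_cat mem_prefs_upto; apply/idP/orP; last first.
  case=> /allpairsP[[q l] /= []]; rewrite mem_prefs_upto L_mem => /andP[/eqP qn qm] lm ->.
    by rewrite size_rcons qn eqxx letters_upto_rcons_mem //.
  by rewrite size_rcons size_map qn eqxx letters_upto_rcons_bump.
case/lastP: p => [//|q l]; rewrite size_rcons eqSS => /andP[qn qm].
have lm : 0 < l <= m.+1 by rewrite -(letters_upto_mem qm) mem_rcons mem_head.
have [lq|lq] := boolP (l \in q); [left|right]; apply/allpairsP.
  exists (q, l); split=> //; last by rewrite L_mem.
  rewrite mem_prefs_upto qn; apply: mem_letters_upto => x.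
  by rewrite -(letters_upto_mem qm) mem_rcons inE; case: eqVneq => [->|//]; rewrite lq.
(* As [q] avoids l, closing the gap and reopening it loses nothing. *)
have qK : map (bump l) (map (unbump l) q) = q.
  rewrite -map_comp map_id_in // => x xq /=; rewrite unbumpK // inE.
  by apply: contraNneq lq => <-.
exists (map (unbump l) q, l); split=> /=; last by rewrite qK.
  by rewrite mem_prefs_upto size_map qn -(letters_upto_rcons_bump _ lm) qK.
by rewrite L_mem.
Qed.

(** On a word whose letters are {1, ..., r} this is r ([top_letters_upto]), so that cuts can be
    tested without quantifying over r. *)
Definition top (p : seq nat) : nat := \max_(x <- p) x.

Lemma top_letters_upto p m : letters_upto p m -> top p = m.
Proof.
move=> pm; apply/eqP; rewrite eqn_leq; apply/andP; split.
  apply/bigmax_leqP_seq => x; rewrite (letters_upto_mem pm); lia.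
case: m pm => // m pm; apply: (@leq_bigmax_seq _ p xpredT id m.+1) => //.
by rewrite (letters_upto_mem pm); lia.
Qed.

Definition prefs n : seq (seq nat) :=
  [seq p <- words (iota 1 n) n | letters_upto p (top p)].

Lemma mem_prefs n p : (p \in prefs n) = (size p == n) && letters_upto p (top p).
Proof. by rewrite -mem_prefs_upto !mem_filter. Qed.

Lemma prefs_uniq n : uniq (prefs n).
Proof. by rewrite filter_uniq ?words_uniq ?iota_uniq. Qed.

(** The lists [prefs_upto n m] are disjoint for different m, since m is the largest letter. *)
Lemma size_prefs n : size (prefs n) = \sum_(m < n.+1) surjections n m.
Proof.
under eq_bigr do rewrite -size_prefs_upto.
have /perm_size -> : perm_eq (prefs n) [seq p | m <- iota 0 n.+1, p <- prefs_upto n m].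
  apply: uniq_perm; first exact: prefs_uniq.
    apply: allpairs_uniq_dep; first exact: iota_uniq.
      by move=> m _; apply: prefs_upto_uniq.
    move=> _ _ /allpairsPdep[m [p [_ pm ->]]] /allpairsPdep[m' [p' [_ pm' ->]]] /= e.
    move: pm pm'; rewrite !mem_prefs_upto => /andP[_ /top_letters_upto pm] /andP[_ /top_letters_upto pm'].
    by rewrite -pm -pm' -e.
  move=> p; apply/idP/allpairsPdep => [|[m [q [_]]]].
    rewrite mem_prefs => /andP[pn pm]; exists (top p), p; split=> //.
      by rewrite mem_iota add0n ltnS -(eqP pn) letters_upto_size.
    by rewrite mem_prefs_upto pn.
  by rewrite mem_prefs_upto mem_prefs => /andP[qn qm] ->; rewrite qn (top_letters_upto qm).
by rewrite size_allpairs_dep (sumn_iota (fun m => size (prefs_upto n m)) n.+1).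
Qed.

(** * Cuts of preference functions *)

Definition pref_cut (p : seq nat) (j : nat) : bool :=
  letters_upto (take j p) (top (take j p)) && all (ltn (top (take j p))) (drop j p).

Definition pref_glue (h g : seq nat) : seq nat := h ++ map (addn (top h)) g.

Definition pref_suffix (a : nat) (p : seq nat) : seq nat :=
  map (subn^~ (top (take a p))) (drop a p).

Lemma letters_upto_cat_add h g a m : letters_upto h a -> letters_upto g m ->
  letters_upto (h ++ map (addn a) g) (a + m).
Proof.
move=> ha gm; apply: mem_letters_upto => x; rewrite mem_cat (letters_upto_mem ha).
have [ax|xa] := leqP a x; last by rewrite (_ : 0 < x <= a = (0 < x <= a + m)) ?orb_idr //;
  [case/mapP=> y|]; lia.
have -> : (x \in map (addn a) g) = (x - a \in g).
  by rewrite -{1}(subnKC ax) mem_map //; apply: addnI.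
by rewrite (letters_upto_mem gm); lia.
Qed.

Lemma letters_upto_cat_sub h g a m : letters_upto h a -> all (ltn a) g ->
  letters_upto (h ++ g) m -> letters_upto (map (subn^~ a) g) (m - a).
Proof.
move=> ha /allP ag hgm; apply: mem_letters_upto => x.
apply/mapP/idP => [[y yg ->]|xm].
  have := letters_upto_mem hgm y; rewrite mem_cat yg orbT.
  by have /= := ag y yg; lia.
exists (x + a); last by lia.
have := letters_upto_mem hgm (x + a); rewrite mem_cat (letters_upto_mem ha).
by case: (_ \in g) => //; lia.
Qed.

(** The letters of [g] are raised above those of [h]. A prefix reaching beyond [h] then has an
    initial interval of letters exactly when its part inside [g] has one, so later cuts are those of
    [g]. *)
Lemma pref_glueP a b h g : h \in prefs a -> g \in prefs b -> 0 < b ->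
  [/\ pref_glue h g \in prefs (a + b), take a (pref_glue h g) = h,
      pref_suffix a (pref_glue h g) = g, pref_cut (pref_glue h g) a
    & forall c, 0 < c < b -> pref_cut (pref_glue h g) (a + c) = pref_cut g c].
Proof.
rewrite !mem_prefs => /andP[/eqP ha hm] /andP[/eqP gb gm] b0.
have hgm := letters_upto_cat_add hm gm.
have tk : take a (pref_glue h g) = h by rewrite /pref_glue -ha take_size_cat.
have dr : drop a (pref_glue h g) = map (addn (top h)) g.
  by rewrite /pref_glue -ha drop_size_cat.
have g0 x : x \in g -> 0 < x by rewrite (letters_upto_mem gm); lia.
split=> //.
- by rewrite /pref_glue size_cat size_map ha gb eqxx (top_letters_upto hgm).
- rewrite /pref_suffix tk dr -map_comp map_id_in // => x _ /=; lia.
- rewrite /pref_cut tk dr hm /= all_map; apply/allP=> x /g0 /=; lia.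
move=> c cb.
have tk' : take (a + c) (pref_glue h g) = h ++ map (addn (top h)) (take c g).
  by rewrite /pref_glue takeD -/(pref_glue h g) tk dr map_take.
have dr' : drop (a + c) (pref_glue h g) = map (addn (top h)) (drop c g).
  by rewrite addnC -drop_drop dr map_drop.
(* A prefix containing all of [h] has at least the letters up to [top h], hence the bound on m. *)
have lt : letters_upto (h ++ map (addn (top h)) (take c g)) =1
          fun m => (top h <= m) && letters_upto (take c g) (m - top h).
  move=> m; apply/idP/andP => [hcm|[hle tm]].
    split.
      case: (posnP (top h)) => [->//|h0].
      have := letters_upto_mem hcm (top h); rewrite mem_cat (letters_upto_mem hm); lia.
    have al : all (ltn (top h)) (map (addn (top h)) (take c g)).
      by rewrite all_map; apply/allP=> x /mem_take/g0 /=; lia.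
    have := letters_upto_cat_sub hm al hcm.
    by rewrite -map_comp map_id_in // => x _ /=; lia.
  by have := letters_upto_cat_add hm tm; rewrite subnKC.
rewrite /pref_cut tk' dr' lt.
(* The maximum of the longer prefix is computed only when its letters form an initial interval;
   otherwise both sides are false. *)
have [tg|tg] := boolP (letters_upto (take c g) (top (take c g))).
  have := letters_upto_cat_add hm tg => /top_letters_upto ->.
  rewrite leq_addr addKn tg /= all_map; apply: eq_all => x /=; lia.
apply/negbTE; apply: contraNN tg => /andP[/andP[_ tg] _].
by rewrite (top_letters_upto tg).
Qed.

Lemma pref_cutP n a p : p \in prefs n -> a < n -> pref_cut p a ->
  [/\ take a p \in prefs a, pref_suffix a p \in prefs (n - a)
    & pref_glue (take a p) (pref_suffix a p) = p].
Proof.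
rewrite !mem_prefs => /andP[/eqP pn pm] an /andP[tm da].
have dm : letters_upto (pref_suffix a p) (top p - top (take a p)).
  by apply: letters_upto_cat_sub tm da _; rewrite cat_take_drop.
rewrite tm size_take pn an eqxx (top_letters_upto dm) dm size_map size_drop pn eqxx.
split=> //; rewrite /pref_glue /pref_suffix -map_comp map_id_in ?cat_take_drop // => x.
by move/(allP da) => /=; lia.
Qed.

Lemma pref_cut0 n p : p \in prefs n -> pref_cut p 0.
Proof.
rewrite mem_prefs /pref_cut take0 drop0 /top big_nil => /andP[_ pm] /=.
by apply/allP=> x; rewrite (letters_upto_mem pm) => /andP[].
Qed.

Import Order.TTheory GRing.Theory Num.Theory.
Local Open Scope ring_scope.

(** * Signed words *)

Lemma uniq_map_inj (T1 T2 : eqType) (f : T1 -> T2) (s : seq T1) :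
  uniq (map f s) -> {in s &, injective f}.
Proof.
elim: s => //= z s IHs /andP[zs us] x y; rewrite !inE.
case/predU1P=> [->|xs] /predU1P[->|ys] // e; last exact: IHs.
  by rewrite e map_f in zs.
by rewrite -e map_f in zs.
Qed.

(** The absolute values are then 0, ..., n - 1, each once. As 0 has no sign, for n > 0 there are as
    many such words as elements of the group of type D_n. *)
Definition signed_word (n : nat) (u : seq int) : bool :=
  [&& size u == n, uniq (map absz u) & all (fun x => absz x < n)%N u].

Lemma signed_word_mem n u a : signed_word n u -> (a < n)%N -> a \in map absz u.
Proof.
case/and3P=> /eqP un uu /allP uA an.
have sub : {subset map absz u <= iota 0 n}.
  by move=> _ /mapP[x xu ->]; rewrite mem_iota /= add0n uA.
have [] := uniq_min_size uu sub _; first by rewrite size_iota size_map un.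
by move=> _ ->; rewrite mem_iota.
Qed.

Lemma signed_word_inj n u : signed_word n u -> {in u &, injective absz}.
Proof. by case/and3P=> _ /uniq_map_inj. Qed.

Definition low (u : seq int) : bool :=
  all (fun p => - p%:Z <= nth 0 u p) (iota 0 (size u)).

Lemma lowP u : reflect (forall p, (p < size u)%N -> - p%:Z <= nth 0 u p) (low u).
Proof.
apply: (iffP allP) => H p; first by move=> pu; apply: H; rewrite mem_iota.
by rewrite mem_iota => /andP[_]; apply: H.
Qed.

(** The alphabet is -n, ..., n - 1, which contains every entry that [signed_word] allows. *)
Definition low_words n : seq (seq int) :=
  [seq u <- words [seq x%:Z - n%:Z | x <- iota 0 n.*2] n | signed_word n u && low u].

Lemma mem_low_words n u : (u \in low_words n) = signed_word n u && low u.
Proof.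
rewrite mem_filter mem_words; case H: (signed_word n u) => //=.
case: low => //=; case/and3P: H => -> _ /allP uA /=.
apply/allP => x /uA xn /=; apply/mapP; exists (absz (x + n%:Z)); last lia.
by rewrite mem_iota; lia.
Qed.

Lemma low_words_uniq n : uniq (low_words n).
Proof.
rewrite filter_uniq // words_uniq // map_inj_uniq ?iota_uniq //.
by move=> x y /addIr [].
Qed.

Definition nonneg (x : int) := 0 <= x.
Definition positive (x : int) := 0 < x.

Definition flip (e : bool) (x : int) : int := if e then - x else x.

Lemma absz_flip e x : absz (flip e x) = absz x.
Proof. by case: e => //=; rewrite abszN. Qed.

(* The last entry of a low word of length [n.+1] is, up to sign, an arbitrary
   nonnegative entry [y] of a low word [h] of length [n], whose place is taken
   by the value [n]. *)
Definition grow (e : bool) (h : seq int) (y : int) : seq int :=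
  rcons [seq if x == y then (size h)%:Z else x | x <- h] (flip e y).

(** The new last entry has absolute value at most n, so it respects the lower bound with either
    sign, and the entry put in place of [y] is nonnegative. For y = n nothing is replaced. *)
Lemma growP e n h y : signed_word n h -> low h -> y \in rcons h n%:Z -> 0 <= y ->
  signed_word n.+1 (grow e h y) && low (grow e h y).
Proof.
move=> hn hl yh y0; have [/eqP hs hu /allP hA] := and3P hn.
have inj := signed_word_inj hn; rewrite /grow hs.
have yn : (absz y <= n)%N.
  by move: yh; rewrite mem_rcons inE => /predU1P[->|/hA /ltnW].
set f := fun x => _.
have nh x : x \in h -> x != n%:Z by move=> /hA; lia.
have absf x : x \in h -> absz (f x) = (if absz x == absz y then n else absz x).
  move=> xh; rewrite /f; case: (eqVneq x y) => [->|xy]; first by rewrite eqxx.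
  rewrite ifN //; apply: contraNneq xy => e1.
  move: yh; rewrite mem_rcons inE => /predU1P[yE|yh]; last by rewrite (inj x y).
  by have := hA x xh; rewrite e1 yE ltnn.
apply/andP; split.
  apply/and3P; split; first by rewrite size_rcons size_map hs.
    rewrite map_rcons rcons_uniq absz_flip; apply/andP; split.
      apply/negP=> /mapP[_ /mapP[x xh ->] /eqP]; rewrite (absf x xh).
      by have := hA x xh; case: (eqVneq (absz x) (absz y)); lia.
    rewrite -map_comp map_inj_in_uniq; first exact: map_uniq hu.
    move=> x x' xh xh' /=; rewrite (absf x xh) (absf x' xh').
    have := hA x xh; have := hA x' xh'.
    by case: eqP => [e1|e1]; case: eqP => [e2|e2] ? ? e3; apply: inj => //; lia.
  apply/allP=> x; rewrite mem_rcons inE => /predU1P[->|/mapP[z zh ->]].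
    by rewrite absz_flip; lia.
  by rewrite (absf z zh); have := hA z zh; case: ifP; lia.
apply/lowP=> p; rewrite size_rcons size_map hs ltnS nth_rcons size_map hs => pn.
case: ltnP => [lt|ge]; last by rewrite (_ : p == n); [case: e => /=|]; lia.
rewrite (nth_map 0) ?hs // /f; case: ifP => _; first lia.
by apply: (lowP _ hl); rewrite hs.
Qed.

Definition low_words_upto n m : seq (seq int) :=
  [seq u <- low_words n | count nonneg u == m].

Lemma low_words_upto_uniq n m : uniq (low_words_upto n m).
Proof. by rewrite filter_uniq ?low_words_uniq. Qed.

Lemma mem_low_words_upto n m u :
  (u \in low_words_upto n m) = [&& count nonneg u == m, signed_word n u & low u].
Proof. by rewrite mem_filter mem_low_words. Qed.

Lemma count_nonneg_grow e h y : 0 <= y ->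
  count nonneg (grow e h y) = (count nonneg h + nonneg (flip e y))%N.
Proof.
move=> y0; rewrite /grow -cats1 count_cat /= addn0; congr (_ + _)%N.
rewrite count_map; apply: eq_count => x /=; rewrite /nonneg.
by case: eqP => // ->; lia.
Qed.

(** [y] is the absolute value of the last entry, and putting [y] back for n restores [h]. The sign
    is not recovered, since it does not show when y = 0. *)
Lemma grow_inj e e' n h y h' y' : signed_word n h -> signed_word n h' ->
    y \in rcons h n%:Z -> y' \in rcons h' n%:Z -> 0 <= y -> 0 <= y' ->
  grow e h y = grow e' h' y' -> h = h' /\ y = y'.
Proof.
move=> hn hn' yh yh' y0 y0' /rcons_inj[].
have [/eqP hs hu /allP hA] := and3P hn.
have [/eqP hs' hu' /allP hA'] := and3P hn'.
rewrite hs hs' => e1 e2.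
have yy' : y = y' by have := congr1 absz e2; rewrite !absz_flip; lia.
split=> //; subst y'.
have K k : (forall x, x \in k -> (absz x < n)%N) ->
    [seq (if x == n%:Z then y else x) | x <- [seq (if x == y then n%:Z else x) | x <- k]] = k.
  move=> kA; rewrite -map_comp map_id_in // => x xk /=.
  case: (eqVneq x y) => [->|xy]; first by rewrite eqxx.
  by case: eqP => // xn; have := kA x xk; rewrite xn absz_nat ltnn.
by rewrite -(K h) // -(K h') // e1.
Qed.

(** Put the absolute value of the last entry in the place of n, and drop the last entry. *)
Lemma grow_surj n u : signed_word n.+1 u -> low u ->
  exists h y, [/\ signed_word n h, low h, y \in rcons h n%:Z, 0 <= y &
                  u = grow (last 0 u < 0) h y].
Proof.
case/lastP: u => [//|w z] un ul.
have [us uu /allP uA] := and3P un.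
have inj := signed_word_inj un.
have ws : size w = n by move: us; rewrite size_rcons eqSS => /eqP.
(* Before the last place, -n would fall below the bound of [low]. *)
have wn x : x \in w -> absz x = n -> x = n%:Z.
  move=> xw xn; suff: 0 <= x by lia.
  have iw : (index x w < size w)%N by rewrite index_mem.
  have := lowP _ ul (index x w); rewrite size_rcons ltnS ltnW // => /(_ isT).
  by rewrite nth_rcons iw nth_index //; lia.
pose y := (absz z)%:Z; pose f x := if x == n%:Z then y else x.
have zn : (absz z <= n)%N by have := uA z; rewrite mem_rcons mem_head => /(_ isT).
have wz x : x \in w -> absz x != absz z.
  move: uu; rewrite map_rcons rcons_uniq => /andP[zw _] xw.
  by apply: contraNneq zw => <-; rewrite map_f.
have wA x : x \in w -> (absz x <= n)%N.
  by move=> xw; have := uA x; rewrite mem_rcons inE xw orbT => /(_ isT).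
have fA x : x \in w -> absz (f x) = if absz x == n then absz z else absz x.
  move=> xw; rewrite /f; case: (eqVneq x n%:Z) => [->|xn]; first by rewrite eqxx.
  by rewrite ifN //; apply: contraNneq xn => /(wn _ xw) ->.
have sf : size (map f w) = n by rewrite size_map.
exists (map f w), y; split.
- apply/and3P; split; first by rewrite sf.
    rewrite -map_comp map_inj_in_uniq.
      by move: uu; rewrite map_rcons rcons_uniq => /andP[_ /map_uniq].
    move=> x x' xw xw' /=; rewrite (fA x xw) (fA x' xw').
    have := wz x xw; have := wz x' xw'.
    have xu : x \in rcons w z by rewrite mem_rcons inE xw orbT.
    have xu' : x' \in rcons w z by rewrite mem_rcons inE xw' orbT.
    by case: (eqVneq (absz x) n) => [e1|e1]; case: (eqVneq (absz x') n) => [e2|e2] ? ? e3;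
      apply: inj => //; lia.
  apply/allP=> _ /mapP[x xw ->]; rewrite (fA x xw).
  by have := wz x xw; have := wA x xw; case: (eqVneq (absz x) n); lia.
- apply/lowP=> p; rewrite sf => pn; rewrite (nth_map 0) ?ws // /f.
  case: ifP => _; first lia.
  have := lowP _ ul p; rewrite size_rcons ws ltnS ltnW // => /(_ isT).
  by rewrite nth_rcons ws pn.
(* If the last entry is not n up to sign, then n occurs in [w] and has become [y]. *)
- rewrite mem_rcons inE; case: (eqVneq y n%:Z) => //= yn.
  have := signed_word_mem un (ltnSn n).
  rewrite map_rcons mem_rcons inE => /predU1P[e|/mapP[x xw e]].
    by rewrite /y -e eqxx in yn.
  by apply/mapP; exists x => //; rewrite /f (wn x xw) ?eqxx.
- by rewrite /y; lia.
rewrite /grow sf last_rcons; congr rcons; last first.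
  by rewrite /flip /y; case: ltP; lia.
rewrite -map_comp map_id_in // => x xw /=; rewrite /f.
case: (eqVneq x n%:Z) => [->|xn]; first by rewrite eqxx.
by case: eqP => // e; have := wz x xw; rewrite e /y absz_nat eqxx.
Qed.

Lemma zero_mem_signed_word n u : signed_word n.+1 u -> 0 \in u.
Proof.
by move=> un; have /mapP[x xu /esym/eqP] := signed_word_mem un (ltn0Sn n);
  rewrite absz_eq0 => /eqP xE; rewrite -xE.
Qed.

Lemma count_positive n u : signed_word n.+1 u ->
  count nonneg u = (count positive u).+1.
Proof.
move=> un; have u0 := zero_mem_signed_word un.
have /map_uniq uu : uniq (map absz u) by case/and3P: un.
rewrite -addn1 -(_ : count (pred1 0) u = 1%N); last by rewrite count_uniq_mem ?u0.
by elim: u {un u0 uu} => //= x u ->; rewrite /nonneg /positive; lia.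
Qed.

Lemma signed_word_rcons n h : signed_word n h -> signed_word n.+1 (rcons h n%:Z).
Proof.
case/and3P=> hs hu /allP hA; apply/and3P; split; first by rewrite size_rcons eqSS.
  rewrite map_rcons rcons_uniq hu andbT; apply/mapP=> -[x /hA]; lia.
by apply/allP=> x; rewrite mem_rcons inE => /predU1P[->|/hA]; lia.
Qed.

(** The last entry is [y] or [- y] for a nonnegative entry [y] of [rcons h n]; the second form
    requires y > 0, so that the last entry 0 is counted only once. In both cases the number of
    choices for [y] is the new number of nonnegative entries, as in the recurrence of
    [surjections]. *)
Lemma size_low_words_upto n m : size (low_words_upto n m) = surjections n m.
Proof.
elim: n m => [|n IHn] m; first by case: m.
case: m => [|m]; rewrite [surjections _ _]/=.
  (* The entry 0 is nonnegative, so m = 0 is impossible in positive length. *)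
  rewrite mul0n; case E: (low_words_upto _ _) => [//|u s].
  have: u \in low_words_upto n.+1 0 by rewrite E mem_head.
  by rewrite mem_low_words_upto => /and3P[cu /count_positive cE]; rewrite cE in cu.
pose A := [seq grow false h y | h <- low_words_upto n m,
                                y <- [seq y <- rcons h n%:Z | nonneg y]].
pose B := [seq grow true h y | h <- low_words_upto n m.+1,
                               y <- [seq y <- rcons h n%:Z | positive y]].
have uniq_rcons h : signed_word n h -> uniq (rcons h n%:Z).
  by move/signed_word_rcons/and3P => [_ /map_uniq].
have cnt h : count nonneg (rcons h n%:Z) = (count nonneg h).+1.
  by rewrite -cats1 count_cat /= addn0 addn1.
have -> : (m.+1 * (surjections n m.+1 + surjections n m) = size (A ++ B))%N.
  rewrite size_cat !size_allpairs_dep -!IHn mulnDr addnC; congr (_ + _)%N.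
    rewrite sumnE big_map (eq_big_seq (fun=> m.+1)).
      by rewrite big_const_seq count_predT iter_addn_0.
    move=> h; rewrite mem_low_words_upto => /and3P[/eqP hm _ _].
    by rewrite size_filter cnt hm.
  rewrite sumnE big_map (eq_big_seq (fun=> m.+1)).
    by rewrite big_const_seq count_predT iter_addn_0.
  move=> h; rewrite mem_low_words_upto => /and3P[/eqP hm hn _].
  by rewrite size_filter; have := count_positive (signed_word_rcons hn); rewrite cnt hm => -[].
apply: perm_size; apply: uniq_perm; first exact: low_words_upto_uniq.
  rewrite cat_uniq; apply/and3P; split.
  - apply: allpairs_uniq_dep; first exact: low_words_upto_uniq.
      move=> h; rewrite mem_low_words_upto => /and3P[_ hn _].
      exact/filter_uniq/uniq_rcons.
    move=> _ _ /allpairsPdep[h [y [hP yP ->]]] /allpairsPdep[h' [y' [hP' yP' ->]]] /= e.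
    move: hP hP' yP yP'; rewrite !mem_low_words_upto !mem_filter.
    move=> /and3P[_ hn _] /and3P[_ hn' _] /andP[y0 yh] /andP[y0' yh'].
    by have [-> ->] := grow_inj hn hn' yh yh' y0 y0' e.
  - apply/hasPn=> _ /allpairsPdep[h [y [_ yP ->]]]; apply/negP.
    case/allpairsPdep=> h' [y' [_ yP' /(congr1 (last 0))]]; rewrite !last_rcons /=.
    move: yP yP'; rewrite !mem_filter /nonneg /positive => /andP[y0 _] /andP[y0' _]; lia.
  - apply: allpairs_uniq_dep; first exact: low_words_upto_uniq.
      move=> h; rewrite mem_low_words_upto => /and3P[_ hn _].
      exact/filter_uniq/uniq_rcons.
    move=> _ _ /allpairsPdep[h [y [hP yP ->]]] /allpairsPdep[h' [y' [hP' yP' ->]]] /= e.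
    move: hP hP' yP yP'; rewrite !mem_low_words_upto !mem_filter.
    move=> /and3P[_ hn _] /and3P[_ hn' _] /andP[/ltW y0 yh] /andP[/ltW y0' yh'].
    by have [-> ->] := grow_inj hn hn' yh yh' y0 y0' e.
move=> u; rewrite mem_cat mem_low_words_upto; apply/idP/orP; last first.
  case=> /allpairsPdep[h [y []]]; rewrite mem_low_words_upto mem_filter => /and3P[/eqP hm hn hl] /andP[y0 yh] ->.
    by rewrite growP // count_nonneg_grow // hm /flip y0 addn1 eqxx.
  rewrite growP ?ltW // count_nonneg_grow ?ltW // hm andbT.
  by move: y0; rewrite /positive /nonneg /=; lia.
case/and3P=> um un ul; have [h [y [hn hl yh y0 uE]]] := grow_surj un ul.
move: um; rewrite {1}uE count_nonneg_grow // => um.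
have [neg|pos] := boolP (last 0 u < 0); [right|left]; apply/allpairsPdep; exists h, y.
  rewrite neg in um uE; have yP : 0 < y by move: neg; rewrite uE last_rcons /=; lia.
  rewrite mem_low_words_upto mem_filter hn hl yh !andbT; split=> //.
    by move: um; rewrite /= (_ : nonneg (- y) = false) ?addn0 //; rewrite /nonneg; lia.
rewrite mem_low_words_upto mem_filter hn hl yh !andbT; split=> //.
  by move: um; rewrite (negPf pos) /= (_ : nonneg y) ?addn1.
by rewrite (negPf pos) in uE.
Qed.

Lemma size_low_words n : size (low_words n) = (\sum_(m < n.+1) surjections n m)%N.
Proof.
under eq_bigr do rewrite -size_low_words_upto.
have /perm_size -> : perm_eq (low_words n) [seq p | m <- iota 0 n.+1, p <- low_words_upto n m].
  apply: uniq_perm; first exact: low_words_uniq.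
    apply: allpairs_uniq_dep; first exact: iota_uniq.
      by move=> m _; apply: low_words_upto_uniq.
    move=> _ _ /allpairsPdep[m [p [_ pm ->]]] /allpairsPdep[m' [p' [_ pm' ->]]] /= e.
    move: pm pm'; rewrite !mem_filter => /andP[/eqP pm _] /andP[/eqP pm' _].
    by rewrite -pm -pm' -e.
  move=> p; apply/idP/allpairsPdep => [pn|[m [q [_]]]]; last first.
    by rewrite mem_filter => /andP[_ qn] ->.
  exists (count nonneg p), p; split=> //; last by rewrite mem_filter eqxx.
  rewrite mem_iota add0n ltnS (leq_trans (count_size _ _)) //.
  by move: pn; rewrite mem_low_words => /andP[/and3P[/eqP ->]].
by rewrite size_allpairs_dep (sumn_iota (fun m => size (low_words_upto n m)) n.+1).
Qed.

(** * Cuts of low words *)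

Definition block (u : seq int) (a : nat) : bool := all (fun x => absz x < a)%N (take a u).

(** For a > 0 this is a violation of the parity condition at a; 0 is made a cut so that every word
    has one. *)
Definition odd_cut (u : seq int) (a : nat) : bool :=
  (a == 0)%N || block u a && odd (count positive (drop a u)).

(** Pushes entries away from 0. The entry 0 acquires a sign, which e selects. *)
Definition shift_up (a : nat) (e : bool) (x : int) : int :=
  if x == 0 then flip e a%:Z else if 0 < x then x + a%:Z else x - a%:Z.

Definition shift_down (a : nat) (x : int) : int :=
  if 0 <= x then x - a%:Z else x + a%:Z.

(** When [h] is not empty, the sign given to the entry 0 of [g] makes the number of positive entries
    after [h] odd. *)
Definition word_glue (h g : seq int) : seq int :=
  h ++ map (shift_up (size h) (odd (count positive g))) g.

Definition word_suffix (a : nat) (u : seq int) : seq int := map (shift_down a) (drop a u).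

Lemma absz_shift_up a e x : absz (shift_up a e x) = (absz x + a)%N.
Proof. by rewrite /shift_up; case: eqP => [->|_]; [case: e|case: ltP]; rewrite /flip; lia. Qed.

Lemma shift_upK a e x : shift_down a (shift_up a e x) = x.
Proof.
rewrite /shift_up; case: eqP => [->|x0].
  by rewrite /shift_down /flip; case: e; case: leP; lia.
by case: ltP => h; rewrite /shift_down; case: leP; lia.
Qed.

Lemma shift_downK a e x : (a <= absz x)%N -> (absz x = a -> x = flip e a%:Z) ->
  shift_up a e (shift_down a x) = x.
Proof.
move=> ax xa; rewrite /shift_down; case: leP => x0; rewrite /shift_up.
  case: eqP => h; first by rewrite -xa //; lia.
  by case: ltP => h'; lia.
case: eqP => h; first by rewrite -xa //; lia.
by case: ltP => h'; lia.
Qed.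

Lemma signed_word_block n u a : signed_word n u -> (a <= n)%N -> block u a ->
  signed_word a (take a u).
Proof.
case/and3P=> /eqP un uu _ an ua; apply/and3P; split=> //.
  by rewrite size_take un; case: ltnP => //; lia.
by rewrite map_take take_uniq.
Qed.

Lemma block_drop n u a x : signed_word n u -> (a <= n)%N -> block u a ->
  x \in drop a u -> (a <= absz x)%N.
Proof.
move=> un an ua xd; rewrite leqNgt; apply/negP=> xa.
have xt := signed_word_mem (signed_word_block un an ua) xa.
case/and3P: un => _; rewrite -{1}(cat_take_drop a u) map_cat cat_uniq.
by case/and3P=> _ /hasPn /(_ (absz x)); rewrite map_f // => /(_ isT) /negP.
Qed.

Lemma lowP_drop u a : low u -> forall p, (p < size u - a)%N ->
  - (a + p)%N%:Z <= nth 0 (drop a u) p.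
Proof. by move=> ul p pu; rewrite nth_drop; apply: (lowP _ ul); rewrite -ltn_subRL. Qed.

Lemma count_shift_up a e g : (0 < a)%N ->
  count positive (map (shift_up a e) g) =
  (count positive g + ~~ e * count (pred1 0%R) g)%N.
Proof.
move=> a0; elim: g => [|x g IHg] /=; first by rewrite muln0.
rewrite IHg mulnDr addnACA; congr (_ + _)%N.
rewrite /positive /shift_up; case: eqP => [->|x0] /=; first by case: (e); rewrite /flip; lia.
by rewrite muln0 addn0; case: (ltP 0%R x) => h; lia.
Qed.

Lemma count_zero n g : signed_word n g -> (0 < n)%N -> count (pred1 0%R) g = 1%N.
Proof.
case: n => // n gn _; have := zero_mem_signed_word gn.
by case/and3P: gn => _ /map_uniq gu _; rewrite count_uniq_mem // => ->.
Qed.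

Lemma word_glueP a b h g : h \in low_words a -> g \in low_words b -> (0 < b)%N ->
  [/\ word_glue h g \in low_words (a + b), take a (word_glue h g) = h,
      word_suffix a (word_glue h g) = g, odd_cut (word_glue h g) a
    & forall c, (0 < c < b)%N -> odd_cut (word_glue h g) (a + c) = odd_cut g c].
Proof.
rewrite !mem_low_words => /andP[hn hl] /andP[gn gl] b0.
have [/eqP hs hu /allP hA] := and3P hn.
have [/eqP gs gu /allP gA] := and3P gn.
set e := odd (count positive g); set f := shift_up a e.
have uE : word_glue h g = h ++ map f g by rewrite /word_glue hs.
have tk : take a (word_glue h g) = h by rewrite uE -hs take_size_cat.
have dr : drop a (word_glue h g) = map f g by rewrite uE -hs drop_size_cat.
have absf x : absz (f x) = (absz x + a)%N by apply: absz_shift_up.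
split=> //.
- apply/andP; split.
    rewrite uE; apply/and3P; split; first by rewrite size_cat size_map hs gs.
      rewrite map_cat cat_uniq hu /=; apply/andP; split.
        apply/hasPn=> _ /mapP[_ /mapP[y yg ->] ->]; rewrite absf.
        by apply/mapP=> -[x /hA]; lia.
      rewrite -map_comp (eq_map (g := addn^~ a \o absz)); last by move=> x /=.
      by rewrite map_comp map_inj_uniq //; apply: addIn.
    rewrite all_cat; apply/andP; split; apply/allP => x; first by move/hA; lia.
    by case/mapP=> y /gA yb ->; rewrite absf; lia.
  apply/lowP=> p; rewrite uE size_cat size_map hs gs nth_cat hs => pn.
  case: ltnP => pa; first by apply: (lowP _ hl); rewrite hs.
  rewrite (nth_map 0) ?gs; last lia.
  (* Shifting lowers an entry by at most a, while its place moves by a. *)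
  have := lowP _ gl (p - a)%N; rewrite gs => /(_ ltac:(lia)).
  move: (nth _ _ _) => y; rewrite /f /shift_up.
  case: (eqVneq y 0) => h0; first by rewrite /flip; case: (e); lia.
  by case: (ltP 0 y) => h1; lia.
- rewrite /word_suffix dr -map_comp map_id_in // => x _ /=; exact: shift_upK.
- rewrite /odd_cut; case: posnP => //= a0.
  rewrite /block tk dr count_shift_up // (count_zero gn b0) muln1.
  apply/andP; split; first by apply/allP.
  by rewrite oddD -/e; case: (e).
move=> c cb; rewrite /odd_cut addn_eq0 (_ : (c == 0)%N = false) ?andbF /=; last lia.
have tk' : take (a + c) (word_glue h g) = h ++ map f (take c g).
  by rewrite takeD tk dr map_take.
have dr' : drop (a + c) (word_glue h g) = map f (drop c g).
  by rewrite addnC -drop_drop dr map_drop.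
have -> : block (word_glue h g) (a + c) = block g c.
  rewrite /block tk' all_cat (_ : all _ h) /=; last by apply/allP=> x /hA; lia.
  by rewrite all_map; apply: eq_all => x /=; rewrite absf; lia.
case bc: (block g c) => //=; rewrite dr'.
have [c0 /ltnW cb'] := andP cb.
(* For c > 0 the entry 0 of [g] lies in the block, so the entries after it are nonzero and keep
   their signs. *)
congr (odd _); rewrite count_map; apply: eq_in_count => x xd /=.
have := block_drop gn cb' bc xd; rewrite /positive /f /shift_up.
move: (e) => e'; clear -c0.
by case: (eqVneq x 0) => [->|h0]; [|case: (ltP 0 x)]; lia.
Qed.

(** Only the sign of the entry of absolute value a is lost on shifting down, and it is recovered
    from the parity at the cut. *)
Lemma odd_cutP n a u : u \in low_words n -> (a < n)%N -> odd_cut u a ->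
  [/\ take a u \in low_words a, word_suffix a u \in low_words (n - a)
    & word_glue (take a u) (word_suffix a u) = u].
Proof.
rewrite !mem_low_words => /andP[un ul] an.
have [/eqP us uu /allP uA] := and3P un.
rewrite /odd_cut; case: (posnP a) => [->|a0] /=.
  (* For a = 0 the shifts are the identity. *)
  have E : word_suffix 0 u = u.
    rewrite /word_suffix drop0 map_id_in // => x _; rewrite /shift_down; case: ifP; lia.
  rewrite take0 E subn0 un ul; split=> //.
  rewrite /word_glue /= map_id_in // => x _; rewrite /shift_up.
  by case: eqP => [->|_]; [case: odd|case: ifP => _; lia].
case/andP=> ua uo; have tn := signed_word_block un (ltnW an) ua.
have dA x : x \in drop a u -> (a <= absz x < n)%N.
  by move=> xd; rewrite (block_drop un (ltnW an) ua xd) uA // (mem_drop xd).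
have du : uniq (map absz (drop a u)) by rewrite map_drop drop_uniq.
have absd x : x \in drop a u -> absz (shift_down a x) = (absz x - a)%N.
  by move/dA; rewrite /shift_down; case: (leP 0 x); lia.
have sn : signed_word (n - a) (word_suffix a u).
  apply/and3P; split; first by rewrite size_map size_drop us.
    rewrite -map_comp map_inj_in_uniq; first exact: map_uniq du.
    move=> x y xd yd /=; rewrite !absd // => e; apply: (uniq_map_inj du) => //.
    by have := dA _ xd; have := dA _ yd; lia.
  by apply/allP=> _ /mapP[x xd ->]; have := dA _ xd; rewrite absd //; lia.
split.
- rewrite tn; apply/lowP=> p; rewrite size_take us an => pa.
  by rewrite nth_take //; apply: (lowP _ ul); rewrite us (ltn_trans pa).
- rewrite sn; apply/lowP=> p; rewrite size_map size_drop => pn.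
  have pd : (p < size (drop a u))%N by rewrite size_drop.
  rewrite (nth_map 0) //; have := lowP_drop ul pn; have := dA _ (mem_nth 0 pd).
  by move: (nth _ _ _) => y; rewrite /shift_down; case: (leP 0 y); lia.
rewrite /word_glue size_take us an -[RHS](cat_take_drop a); congr (_ ++ _).
rewrite -map_comp map_id_in // => x xd /=.
(* Shifting the suffix up with the right sign for the entry of absolute value a must give an odd
   number of positive entries; hence that sign is the one selected by [word_glue]. *)
have K (e : bool) : e = odd (count positive (word_suffix a u)) ->
    [seq shift_up a (x == - a%:Z) i | i <- word_suffix a u] = drop a u ->
    absz x = a -> x = flip e a%:Z.
  move=> -> E xa; have := uo; rewrite -E count_shift_up //.
  have na : (0 < n - a)%N by lia.
  rewrite (count_zero sn na) muln1 oddD.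
  by rewrite /flip; case: eqP => h; case: odd => //; lia.
apply: shift_downK; first by case/andP: (dA x xd).
move=> xa; apply: K => //; rewrite -map_comp map_id_in // => y yd /=.
apply: shift_downK; first by case/andP: (dA y yd).
move=> ya; have -> : y = x by apply: (uniq_map_inj du) => //; rewrite xa.
by rewrite /flip; case: eqP; lia.
Qed.

Lemma odd_cut0 n u : u \in low_words n -> odd_cut u 0.
Proof. by []. Qed.

(** * Sorting signed words *)

(* One pass of bubble sort on [c :: s], ending with a change of sign of the
   minimum, which has reached the last place. *)
Fixpoint carry (c : int) (s : seq int) : seq int :=
  if s is y :: s' then Num.max c y :: carry (Num.min c y) s' else [:: - c].

Definition carry_sort (u : seq int) : seq int := foldr carry [::] u.

Fixpoint down (n : nat) : seq int := if n is m.+1 then m%:Z :: down m else [::].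

Lemma size_carry c s : size (carry c s) = (size s).+1.
Proof. by elim: s c => //= y s IHs c; rewrite IHs. Qed.

Lemma size_carry_sort u : size (carry_sort u) = size u.
Proof. by elim: u => //= x u IHu; rewrite size_carry IHu. Qed.

Lemma size_down n : size (down n) = n.
Proof. by elim: n => //= n ->. Qed.

Lemma nth_down n i : (i < n)%N -> nth 0 (down n) i = (n.-1 - i)%N%:Z.
Proof.
elim: n i => // n IHn [|i] /=; first by rewrite subn0.
by rewrite ltnS => i_n; rewrite IHn //; congr Posz; lia.
Qed.

Lemma carry_bound n c s : (absz c < n)%N -> all (fun x => absz x < n)%N s ->
  all (fun x => absz x < n)%N (carry c s).
Proof.
elim: s c => [|y s IHs] c cn /=; first by rewrite abszN cn.
by case/andP=> yn sn; rewrite IHs // ?andbT; case: (leP c y); lia.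
Qed.

Lemma carry_sort_bound n u : all (fun x => absz x < n)%N u ->
  all (fun x => absz x < n)%N (carry_sort u).
Proof. by elim: u => //= x u IHu /andP[xn un]; rewrite carry_bound ?IHu. Qed.

(* Comparisons and changes of sign commute with odd monotone maps, so sorting
   can be tested on words over {-1, 0, 1}. *)
Definition threshold (k : nat) (x : int) : int :=
  if k%:Z <= x then 1 else if x <= - k%:Z then -1 else 0.

Lemma thresholdN k x : (0 < k)%N -> threshold k (- x) = - threshold k x.
Proof.
move=> k0; rewrite /threshold.
by case: (leP k%:Z x) => h1; case: (leP x (- k%:Z)) => h2; case: (leP k%:Z (- x)) => h3;
  case: (leP (- x) (- k%:Z)) => h4; lia.
Qed.

Lemma threshold_homo k : (0 < k)%N -> {homo threshold k : x y / x <= y}.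
Proof.
move=> k0 x y xy; rewrite /threshold.
by case: (leP k%:Z x) => h1; case: (leP x (- k%:Z)) => h2; case: (leP k%:Z y) => h3;
  case: (leP y (- k%:Z)) => h4; lia.
Qed.

Lemma map_threshold_carry k c s : (0 < k)%N ->
  map (threshold k) (carry c s) = carry (threshold k c) (map (threshold k) s).
Proof.
move=> k0; elim: s c => [|y s IHs] c /=; first by rewrite thresholdN.
rewrite IHs; case: (leP c y) => [|/ltW] h.
  by rewrite (max_idPr (threshold_homo k0 h)) (min_idPl (threshold_homo k0 h)).
by rewrite (max_idPl (threshold_homo k0 h)) (min_idPr (threshold_homo k0 h)).
Qed.

Lemma map_threshold_carry_sort k u : (0 < k)%N ->
  map (threshold k) (carry_sort u) = carry_sort (map (threshold k) u).
Proof. by move=> k0; elim: u => //= x u IHu; rewrite map_threshold_carry ?IHu. Qed.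

(** * Words over {-1, 0, 1} *)

Definition ternary (x : int) := [|| x == 1, x == 0 | x == -1].
Definition binary (x : int) := (x == 1) || (x == 0).

Lemma carry_min c s : all (fun x => c <= x) s -> carry c s = rcons s (- c).
Proof.
elim: s => //= y s IHs /andP[cy cs].
by rewrite (max_idPr cy) (min_idPl cy) IHs.
Qed.

Lemma carry1_ones m : carry 1 (nseq m 1) = rcons (nseq m 1) (-1).
Proof. by apply: carry_min; rewrite all_nseq lexx orbT. Qed.

Lemma carry1_cat c a s : c <= 1 -> carry c (nseq a 1 ++ s) = nseq a 1 ++ carry c s.
Proof. by move=> c1; elim: a => //= a IHa; rewrite (max_idPr c1) (min_idPl c1) IHa. Qed.

(** The sorted word holds at most one -1. An inserted 1 sends an existing -1 to the end, where it
    becomes 1, and otherwise creates a -1 there; an inserted -1 ends as 1 and affects nothing else.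
    So only the parity of the number of ones matters. *)
Lemma carry_sort_nonzero z : all ternary z -> 0 \notin z ->
  if odd (count (pred1 1) z) then exists a b, carry_sort z = nseq a 1 ++ -1 :: nseq b 1
  else carry_sort z = nseq (size z) 1.
Proof.
have ones b : rcons (nseq b 1) 1 = nseq b.+1 1 :> seq int.
  by elim: b => //= b ->.
elim: z => //= x z IHz /andP[xt zt]; rewrite inE negb_or => /andP[x0 z0].
have := IHz zt z0; have := size_carry_sort z.
have [->|->] : x = 1 \/ x = -1 by move: xt x0; rewrite /ternary; lia.
  rewrite /= oddD /=; case: (odd (count _ z)) => /= sz; [case=> a [b E]|move=> E].
    rewrite E carry1_cat // /= carry_min; last first.
      by rewrite all_nseq; apply/orP; right.
    rewrite opprK ones (_ : nseq a 1 ++ _ = nseq (a + b.+2) 1); last by rewrite nseqD.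
    by rewrite -[RHS]/(nseq (size z).+1 1) -sz E size_cat /= !size_nseq !addnS.
  exists (size z), 0%N; rewrite E carry1_ones -cats1 //.
rewrite /= add0n; case: (odd (count _ z)) => /= sz; [case=> a [b E]|move=> E].
  exists a, b.+1; rewrite E carry_min ?opprK; last first.
    by rewrite all_cat /= !all_nseq !orbT.
  by rewrite rcons_cat rcons_cons ones.
by rewrite E carry_min ?opprK ?ones // all_nseq orbT.
Qed.

(* Once a zero is present, [carry 0] and [carry 1] move the first zero to the
   end, while [carry (-1)] puts a one after all the zeros. *)
Fixpoint misplaced (s : seq int) : nat :=
  if s is x :: s' then (((x == 0)%R && (1%R \in s')) + misplaced s')%N else 0%N.

Lemma misplaced_rcons0 s : misplaced (rcons s 0) = misplaced s.
Proof. by elim: s => //= x s ->; rewrite mem_rcons inE. Qed.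

Lemma misplaced_rcons1 s : misplaced (rcons s 1) = count (pred1 0) s.
Proof. by elim: s => //= x s ->; rewrite mem_rcons inE eqxx andbT. Qed.

Lemma misplaced_no1 s : 1 \notin s -> misplaced s = 0%N.
Proof.
by elim: s => //= x s IHs; rewrite inE negb_or => /andP[_ s1]; rewrite IHs // (negPf s1) andbF.
Qed.

Lemma misplaced_ones m : misplaced (nseq m 1) = 0%N.
Proof. by elim: m. Qed.

Lemma all_binary_ge0 s : all binary s -> all (fun x => 0 <= x) s.
Proof. by apply: sub_all => x; rewrite /binary; lia. Qed.

Lemma carry0_binary s : all binary s -> carry 0 s = rcons s 0.
Proof. by move=> sb; rewrite carry_min ?oppr0 // all_binary_ge0. Qed.

Lemma carryN1_binary s : all binary s -> carry (-1) s = rcons s 1.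
Proof.
move=> sb; rewrite carry_min ?opprK //.
by apply: sub_all sb => x; rewrite /binary; lia.
Qed.

(** The 1 passes over the leading ones up to the first zero, which is then carried to the end. That
    zero was misplaced unless no zero was. *)
Lemma carry1_binary s : all binary s -> 0 \in s ->
  [/\ all binary (carry 1 s), count (pred1 0) (carry 1 s) = count (pred1 0) s
    & misplaced (carry 1 s) = (misplaced s).-1].
Proof.
elim: s => //= y s IHs /andP[yb sb]; rewrite inE.
case/orP: yb => /eqP -> /=; first by case/(IHs sb) => -> -> ->.
move=> _; rewrite carry0_binary // all_rcons sb misplaced_rcons0; split=> //.
  by rewrite -cats1 count_cat /=; lia.
by have [s1|/misplaced_no1 ->] := boolP (1 \in s); lia.
Qed.

Lemma take_subSn (T : Type) (t j : nat) (x : T) s : (j < t)%N ->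
  take (t - j) (x :: s) = x :: take (t - j.+1) s.
Proof. by move=> jt; rewrite -(subnSK jt). Qed.

Lemma take_sub_leq (T : Type) (t j : nat) (s : seq T) : (t <= j)%N -> take (t - j) s = [::].
Proof. by rewrite -subn_eq0 => /eqP ->; rewrite take0. Qed.

(** Let t be the number of zeros. Going from right to left, -1 makes all zeros misplaced, 1 removes
    one misplaced zero if there is any, and 0 raises t alone. So, up to the parity clause, t minus
    the number of misplaced zeros is the length of the initial segment free of -1, capped at t. The
    parity clause comes from the rightmost zero, which is misplaced if a -1 is left among the ones
    after it; this effect lasts only while further zeros are prefixed. *)
Lemma carry_sort_zero z : all ternary z -> 0 \in z ->
  [/\ all binary (carry_sort z),
      count (pred1 0) (carry_sort z) = count (pred1 0) z &
      forall j, (misplaced (carry_sort z) <= j)%N =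
        (-1 \notin take (count (pred1 0%R) z - j)%N z) &&
        ((j == 0)%N && all (pred1 0) (take (count (pred1 0) z) z)
           ==> ~~ odd (count (pred1 1) z))].
Proof.
elim: z => //= x z IHz /andP[xt zt]; rewrite inE => xz0.
case z0: (0 \in z); last first.
  have x0 : x = 0 by move: xz0; rewrite z0 orbF => /eqP.
  have cz : count (pred1 0) z = 0%N.
    by apply/eqP; rewrite -leqn0 leqNgt -has_count has_pred1 z0.
  have := carry_sort_nonzero zt (negbT z0); rewrite x0 /= cz add0n take0.
  case: odd => [[a [b E]]|E].
    (* The 0 passes the first ones and takes the place of the -1, which moves on to the end and
       becomes 1. *)
    have -> : carry 0 (carry_sort z) = nseq a 1 ++ 0 :: nseq b.+1 1.
      rewrite E carry1_cat //= carry_min; last by rewrite all_nseq orbT.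
      by rewrite opprK; congr (_ ++ _ :: _); elim: b {E} => //= b ->.
    have -> : misplaced (nseq a 1 ++ 0 :: nseq b.+1 1) = 1%N.
      by elim: a {E} => [|a //] /=; rewrite misplaced_ones.
    rewrite all_cat /= !all_nseq !orbT count_cat /= !count_nseq /=; split=> //.
    by case=> [|j]; rewrite /= ?subSS ?sub0n ?andbF.
  rewrite E carry0_binary; last by rewrite all_nseq orbT.
  rewrite all_rcons all_nseq orbT misplaced_rcons0; split=> // [|j].
    by rewrite -cats1 count_cat count_nseq.
  by rewrite misplaced_ones implybT andbT; case: j => [|j]; rewrite /= ?take0 ?subSS.
have [sb sc sm] := IHz zt z0; set t := count (pred1 0) z in sc sm *.
have t0 : (0 < t)%N by rewrite -has_count has_pred1.
have s0 : 0 \in carry_sort z by rewrite -has_pred1 has_count sc.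
have take_t y : take t (y :: z) = y :: take t.-1 z by case: (t) t0.
clearbody t; have [->|[->|->]] : x = 1 \/ x = 0 \/ x = -1.
  by move: xt; rewrite /ternary => /or3P[] /eqP; tauto.
- have [c1 c2 c3] := carry1_binary sb s0; rewrite c1 c2 c3 sc; split=> // j.
  rewrite -subn1 leq_subLR add1n sm add0n take_t /= andbF !andbT.
  by case: (ltnP j t) => jt; [rewrite take_subSn|rewrite !take_sub_leq // ltnW].
- rewrite carry0_binary // all_rcons sb misplaced_rcons0; split=> // [|j].
    by rewrite -cats1 count_cat sc addnC.
  rewrite sm add0n add1n; congr (_ && _).
  by case: (ltnP j t.+1) => jt; [rewrite take_subSn // subSS|rewrite !take_sub_leq // ltnW].
- rewrite carryN1_binary // all_rcons sb misplaced_rcons1; split=> // [|j].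
    by rewrite -cats1 count_cat sc addn0.
  rewrite sc !add0n take_t /= andbF andbT.
  by case: (ltnP j t) => jt; [rewrite take_subSn|rewrite take_sub_leq].
Qed.

Lemma misplaced_eq0 s : all binary s ->
  (misplaced s == 0%N) =
  (s == nseq (size s - count (pred1 0%R) s)%N 1 ++ nseq (count (pred1 0) s) 0).
Proof.
have le (k : seq int) : (count (pred1 0%R) k <= size k)%N by apply: count_size.
elim: s => // x s IHs /andP[/orP[]/eqP -> sb] /=.
  by rewrite !add0n subSn //= eqseq_cons eqxx IHs.
rewrite add0n add1n subSS; have [s1|s1] := boolP (1 \in s).
  rewrite add1n /=; apply/esym/negbTE/eqP.
  case: (size s - _)%N => [|m] //= [sE]; move: s1; rewrite sE mem_nseq; lia.
have s0 : all (pred1 0) s.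
  apply/allP=> y ys; case/orP: (allP sb y ys) => //= /eqP yE.
  by rewrite -yE ys in s1.
rewrite misplaced_no1 // eqxx; apply/esym/eqP.
by have /all_pred1P sE := s0; rewrite sE size_nseq count_nseq /= mul1n subnn.
Qed.

Lemma ternary_threshold k u : all ternary (map (threshold k) u).
Proof.
apply/allP=> _ /mapP[x _ ->]; rewrite /ternary /threshold.
by case: ifP => _; [|case: ifP].
Qed.

Lemma threshold_eq0 k x : (0 < k)%N -> (threshold k x == 0) = (absz x < k)%N.
Proof.
move=> k0; rewrite /threshold.
by case: (leP k%:Z x) => h1; [|case: (leP x (- k%:Z)) => h2]; lia.
Qed.

Lemma threshold_eq1 k x : (threshold k x == 1) = (k%:Z <= x).
Proof. by rewrite /threshold; case: ifP => // _; case: ifP. Qed.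

Lemma threshold_eqN1 k x : (0 < k)%N -> (threshold k x == -1) = (x <= - k%:Z).
Proof.
move=> k0; rewrite /threshold.
by case: (leP k%:Z x) => h1; [|case: (leP x (- k%:Z)) => h2]; lia.
Qed.

Lemma signed_word_perm n u : signed_word n u -> perm_eq (map absz u) (iota 0 n).
Proof.
move=> un; have [us uu /allP uA] := and3P un.
apply: uniq_perm => //; first exact: iota_uniq.
move=> a; rewrite mem_iota /=; apply/idP/idP; last exact: signed_word_mem.
by case/mapP=> x /uA xn ->.
Qed.

Lemma count_threshold0 n k u : signed_word n u -> (0 < k <= n)%N ->
  count (pred1 0) (map (threshold k) u) = k.
Proof.
move=> un /andP[k0 kn]; rewrite count_map.
rewrite (eq_count (a2 := preim absz (fun a => a < k)%N)); last first.
  by move=> x /=; rewrite threshold_eq0.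
rewrite -count_map (seq.permP (signed_word_perm un)) -(subnKC kn) iotaD count_cat.
rewrite (eq_in_count (a2 := predT)) ?count_predT ?size_iota; last first.
  by move=> a; rewrite mem_iota => /andP[].
rewrite (eq_in_count (a2 := pred0)) ?count_pred0 ?addn0 // => a.
by rewrite mem_iota add0n => /andP[ka _]; apply/negbTE; rewrite -leqNgt.
Qed.

Lemma map_threshold_down k n : (0 < k <= n)%N ->
  map (threshold k) (down n) = nseq (n - k)%N 1 ++ nseq k 0.
Proof.
move=> /andP[k0 kn]; apply: (@eq_from_nth _ 0) => [|i].
  by rewrite size_map size_down size_cat !size_nseq subnK.
rewrite size_map size_down => i_n; rewrite (nth_map 0) ?size_down // nth_down //.
rewrite nth_cat size_nseq !nth_nseq; case: (ltnP i (n - k)%N) => h.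
  by apply/eqP; rewrite threshold_eq1; lia.
rewrite if_same; apply/eqP; rewrite threshold_eq0 //; lia.
Qed.

(** At place i the thresholds n - i and n - 1 - i bound the entry from above and from below; at the
    two ends the bound on absolute values replaces a missing threshold. *)
Lemma eq_down n s : size s = n -> all (fun x => absz x < n)%N s ->
    (forall k, (0 < k < n)%N -> map (threshold k) s = nseq (n - k)%N 1 ++ nseq k 0) ->
  s = down n.
Proof.
move=> sn /allP sA sT; apply: (@eq_from_nth _ 0); rewrite ?size_down // sn => i i_n.
rewrite nth_down //; have xA := sA _ (mem_nth 0 (_ : i < size s)%N).
have {}xA : (absz (nth 0%R s i) < n)%N by apply: xA; rewrite sn.
have T k : (0 < k < n)%N -> threshold k (nth 0 s i) = (i < n - k)%N%:Z.
  move=> kn; rewrite -(nth_map _ 0) ?sn // sT // nth_cat size_nseq !nth_nseq.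
  by case: ltnP; rewrite ?if_same.
have up : (0 < i)%N -> (absz (nth 0%R s i) < n - i)%N.
  move=> i0; rewrite -threshold_eq0 ?T; lia.
have lo : (i < n.-1)%N -> (n.-1 - i)%N%:Z <= nth 0 s i.
  move=> i1; rewrite -threshold_eq1 T; lia.
by move: (nth _ _ _) up lo xA => x; lia.
Qed.

(** It suffices to sort at every threshold 0 < k < n, where exactly k entries become zero. By
    [carry_sort_zero] with j = 0 this succeeds when the first k entries exceed -k and k is not an
    odd cut. *)
Lemma carry_sort_down n u : signed_word n u -> (0 < n)%N ->
  (carry_sort u == down n) = low u && all (fun c => ~~ odd_cut u c) (iota 1 n.-1).
Proof.
move=> un n0; have [/eqP us uu uA] := and3P un.
have K k : (0 < k < n)%N ->
    (map (threshold k) (carry_sort u) == nseq (n - k)%N 1 ++ nseq k 0) =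
    all (fun x => - k%:Z < x) (take k u) && ~~ odd_cut u k.
  move=> /andP[k0 kn]; have kn' : (0 < k <= n)%N by rewrite k0 ltnW.
  have ct := count_threshold0 un kn'.
  have z0 : 0 \in map (threshold k) u by rewrite -has_pred1 has_count ct.
  have [sb sc sm] := carry_sort_zero (ternary_threshold k u) z0.
  rewrite map_threshold_carry_sort //.
  have := misplaced_eq0 sb; rewrite sc ct size_carry_sort size_map us => <-.
  rewrite -leqn0 sm ct subn0 -map_take eqxx /=; congr (_ && _).
    apply/idP/allP => [h x xt|h].
      rewrite ltNge; apply: contraNN h => xk; apply/mapP; exists x => //.
      by apply/esym/eqP; rewrite threshold_eqN1.
    apply/mapP=> -[x /h xk /esym/eqP]; rewrite threshold_eqN1 //; lia.
  rewrite /odd_cut (_ : (k == 0)%N = false) /=; last lia.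
  have -> : all (pred1 0) (map (threshold k) (take k u)) = block u k.
    by rewrite /block all_map; apply: eq_all => x /=; rewrite threshold_eq0.
  case bk: (block u k) => //=; congr (~~ odd _).
  rewrite count_map (eq_count (a2 := fun x => k%:Z <= x)); last first.
    by move=> x /=; rewrite threshold_eq1.
  rewrite -[in LHS](cat_take_drop k u) count_cat.
  rewrite (eq_in_count (a2 := pred0)) ?count_pred0 ?add0n; last first.
    move=> x /(allP bk) /= xk; apply/negbTE; lia.
  apply: eq_in_count => x /(block_drop un (ltnW kn) bk) kx; rewrite /positive /=.
  clear -k0 kx; lia.
apply/eqP/andP => [uD|[ul /allP uc]].
  have L k : (0 < k < n)%N -> all (fun x => - k%:Z < x) (take k u) && ~~ odd_cut u k.
    by move=> kn; rewrite -K // uD map_threshold_down //; lia.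
  split; last by apply/allP=> c; rewrite mem_iota => cn; case/andP: (L c ltac:(lia)).
  apply/lowP=> p; rewrite us => pn; have pu : (p < size u)%N by rewrite us.
  (* At place p the threshold p + 1 gives the bound; for p = n - 1 it follows from the bound on
     absolute values. *)
  have := allP uA _ (mem_nth 0 pu); have [p1|p1] := ltnP p.+1 n; last first.
    by move: (nth _ _ _) => x; clear -pn p1; lia.
  have /andP[/allP + _] := L p.+1 ltac:(lia).
  move=> /(_ (nth 0 u p)); rewrite -(@nth_take p.+1) // mem_nth.
    by move=> /(_ isT) + _; move: (nth _ _ _) => x; clear; lia.
  by rewrite size_take us p1.
apply: eq_down; rewrite ?size_carry_sort ?carry_sort_bound // => k kn.
apply/eqP; rewrite K //; apply/andP; split; last by apply: uc; rewrite mem_iota; lia.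
apply/allP=> x /(nthP 0)[p]; rewrite size_take us => pk <-.
have {}pk : (p < k)%N by move: pk; case: ifP; lia.
rewrite nth_take //; have /lowP/(_ p) := ul; rewrite us => /(_ ltac:(lia)).
by move: (nth _ _ _) => y; clear -pk; lia.
Qed.

(** * Elementary sorting steps and rows of boxes *)

Lemma flipK e : involutive (flip e).
Proof. by case: e => x //=; rewrite opprK. Qed.

(* Right multiplication by [s_i] on words is [act (i - 1) false] for [i < n],
   and [act (n - 2) true] for [i = n]. *)
Definition act (k : nat) (e : bool) (u : seq int) : seq int :=
  if drop k u is a :: b :: q then take k u ++ [:: flip e b, flip e a & q] else u.

(** Ascents in the group are numerical descents, as the identity corresponds to the decreasing word
    [down n]. *)
Definition asc (k : nat) (e : bool) (u : seq int) : bool :=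
  if drop k u is a :: b :: _ then flip e b < a else true.

(** Serves to run a reading word backwards: the reflection is applied exactly when it is a
    descent. *)
Definition sort_step (k : nat) (e : bool) (u : seq int) : seq int :=
  if asc k e u then u else act k e u.

Definition sort2 (e : bool) (a b : int) : seq int :=
  if flip e b < a then [:: a; b] else [:: flip e b; flip e a].

Lemma split2 (u : seq int) k : (k.+1 < size u)%N ->
  exists p a b q, u = p ++ a :: b :: q /\ size p = k.
Proof.
move=> ku; exists (take k u), (nth 0 u k), (nth 0 u k.+1), (drop k.+2 u).
rewrite -!drop_nth ?cat_take_drop ?(ltnW ku) //; split=> //.
by rewrite size_take (ltnW ku).
Qed.

Lemma actE k e p a b q : size p = k ->
  act k e (p ++ a :: b :: q) = p ++ [:: flip e b, flip e a & q].
Proof. by move=> <-; rewrite /act drop_size_cat // take_size_cat. Qed.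

Lemma ascE k e p a b q : size p = k -> asc k e (p ++ a :: b :: q) = (flip e b < a).
Proof. by move=> <-; rewrite /asc drop_size_cat. Qed.

Lemma sort_stepE k e p a b q : size p = k ->
  sort_step k e (p ++ a :: b :: q) = p ++ sort2 e a b ++ q.
Proof. by move=> pk; rewrite /sort_step ascE // actE // /sort2; case: ifP. Qed.

Lemma size_sort2 e a b : size (sort2 e a b) = 2%N.
Proof. by rewrite /sort2; case: ifP. Qed.

Lemma asc_nth k e u : (k.+1 < size u)%N -> asc k e u = (flip e (nth 0 u k.+1) < nth 0 u k).
Proof.
move=> /split2[p [a [b [q [-> <-]]]]]; rewrite ascE // !nth_cat ltnn subnn.
by rewrite ltnNge leqnSn /= subSnn.
Qed.

Lemma actK k e u : (k.+1 < size u)%N -> act k e (act k e u) = u.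
Proof. by move=> /split2[p [a [b [q [-> pk]]]]]; rewrite !actE // !flipK. Qed.

Lemma signed_word_act n k e u : (k.+1 < n)%N -> signed_word n u -> signed_word n (act k e u).
Proof.
move=> kn /and3P[/eqP us].
have [|p [a [b [q [uE pk]]]]] := @split2 u k; first by rewrite us.
rewrite /signed_word uE actE // !map_cat !all_cat /= !absz_flip => uu uA.
apply/and3P; split; first by rewrite -us uE !size_cat.
  by rewrite -(perm_uniq (_ : perm_eq (map absz p ++ [:: absz a, absz b & map absz q]) _))
             // perm_cat2l -[_ :: _ :: _]/([:: absz a; absz b] ++ _)
             -[X in perm_eq _ X]/([:: absz b; absz a] ++ _) perm_cat2r perm_sym
             (perm_catC [:: absz b] [:: absz a]).
by case/and4P: uA => -> -> -> ->.
Qed.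

Lemma signed_word_neq n p a b q e : signed_word n (p ++ a :: b :: q) -> flip e b != a.
Proof.
case/and3P=> _; rewrite map_cat cat_uniq => /and3P[_ _ /=]; rewrite inE => /andP[].
rewrite negb_or => /andP[ab _] _ _; apply: contraNneq ab => <-.
by rewrite absz_flip.
Qed.

Lemma asc_act n k e u : (k.+1 < n)%N -> signed_word n u -> asc k e (act k e u) = ~~ asc k e u.
Proof.
move=> kn un; have [/eqP us _ _] := and3P un.
have [|p [a [b [q [uE pk]]]]] := @split2 u k; first by rewrite us.
rewrite uE in un *; rewrite actE // !ascE // flipK -leNgt lt_neqAle eq_sym.
by rewrite (signed_word_neq e un).
Qed.

Lemma signed_word_sort_step n k e u : (k.+1 < n)%N -> signed_word n u ->
  signed_word n (sort_step k e u).
Proof. by move=> kn un; rewrite /sort_step; case: ifP => // _; apply: signed_word_act. Qed.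

Lemma sort_stepC k e k' e' u : (k.+1 < k')%N -> (k'.+1 < size u)%N ->
  sort_step k e (sort_step k' e' u) = sort_step k' e' (sort_step k e u).
Proof.
move=> kk' /split2[p [c [d [r [-> pk']]]]].
have [|p' [a [b [q [pE pk]]]]] := @split2 p k; first by rewrite pk'.
have E x : p ++ x = p' ++ a :: b :: (q ++ x) by rewrite pE -catA.
rewrite sort_stepE // !E !sort_stepE //.
have -> : p' ++ sort2 e a b ++ q ++ c :: d :: r = (p' ++ sort2 e a b ++ q) ++ c :: d :: r.
  by rewrite -!catA.
by rewrite sort_stepE -?catA // -pk' pE !size_cat size_sort2.
Qed.

(** Along the boxes the last labels of the rows alternate between s_n and s_(n-1), whereas every
    [carry] ends with a change of sign. The two sorts agree up to the sign of the last entry. *)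
Definition negate_last (e : bool) (s : seq int) : seq int :=
  if s is x :: s' then rcons (belast x s') (flip e (last x s')) else [::].

Lemma negate_last_cons e x y s : negate_last e (x :: y :: s) = x :: negate_last e (y :: s).
Proof. by []. Qed.

Lemma negate_last_down e n : negate_last e (down n.+1) = down n.+1.
Proof. by elim: n => [|n IHn]; [case: e | rewrite negate_last_cons IHn]. Qed.

Lemma negate_last_rcons e s x : negate_last e (rcons s x) = rcons s (flip e x).
Proof. by elim: s => //= y [|z s] //= ->. Qed.

Lemma negate_lastK e : involutive (negate_last e).
Proof.
by case/lastP=> // s x; rewrite !negate_last_rcons flipK.
Qed.


Lemma sort2_max_min a b : sort2 false a b = [:: Num.max a b; Num.min a b].
Proof. by rewrite /sort2 /=; case: (ltP b a). Qed.

(** Before the last place each step is the exchange of maximum and minimum made by [carry]. At the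
    last place the sign of the step cancels the sign on the last entry of [s], so the comparison is
    again that of [carry]. *)
Lemma sort_row e p c s : s != [::] ->
  foldl (fun u k => sort_step k (e && (k == (size p + size s).-1)) u)
        (p ++ c :: negate_last e s) (iota (size p) (size s)) =
  p ++ negate_last (~~ e) (carry c s).
Proof.
elim: s p c => // y [|z s] IHs p c _.
  rewrite /= addn1 eqxx andbT sort_stepE // cats0; congr (_ ++ _).
  by rewrite /sort2 flipK /=; case: (e); case: (ltP y c); rewrite /= ?opprK.
rewrite negate_last_cons [size _]/= [iota _ _]/= [foldl _ _ _]/=.
rewrite (_ : (size p == _) = false) ?andbF; last by rewrite ltn_eqF // addnS addnS ltnS leq_addr.
rewrite sort_stepE // sort2_max_min.
have := IHs (rcons p (Num.max c y)) (Num.min c y) isT.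
rewrite size_rcons !cat_rcons addSnnS => IH; apply: etrans; first exact: IH.
by congr (_ ++ _); rewrite [in RHS]/= -negate_last_cons.
Qed.

Lemma eq_in_foldl (T : eqType) (S : Type) (f g : S -> T -> S) (z : S) (s : seq T) :
  (forall x y, y \in s -> f x y = g x y) -> foldl f z s = foldl g z s.
Proof.
elim: s z => //= y s IHs z fg; rewrite fg ?mem_head // IHs // => x w ws.
by apply: fg; rewrite inE ws orbT.
Qed.

Lemma foldl_mapE (T1 T2 S : Type) (f : S -> T2 -> S) (h : T1 -> T2) z s :
  foldl f z (map h s) = foldl (fun x y => f x (h y)) z s.
Proof. by elim: s z => //= y s IHs z. Qed.

(** Move the head of [s] to the front of [t]: each element that it passes comes later in [s] but
    earlier in [t], so the two steps commute. [P] is an invariant under which commutation is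
    assumed. *)
Lemma foldl_perm (T : eqType) (S : Type) (P : S -> Prop) (f : S -> T -> S) (s t : seq T) :
    (forall x y, y \in s -> P x -> P (f x y)) -> uniq s -> perm_eq s t ->
    (forall y z, subseq [:: y; z] s -> subseq [:: z; y] t ->
       forall x, P x -> f (f x y) z = f (f x z) y) ->
  forall x, P x -> foldl f x s = foldl f x t.
Proof.
elim: s t => [|y s IHs] t Pf; first by move=> _ /perm_size; case: t.
case/andP=> ys us pst C x Px.
have yt : y \in t by rewrite -(perm_mem pst) mem_head.
have [t1 [t2 tE]] : exists t1 t2, t = t1 ++ y :: t2.
  by case/splitPr: yt => t1 t2; exists t1, t2.
subst t; have pst' : perm_eq s (t1 ++ t2).
  by move: pst; rewrite perm_sym -cat1s perm_catCA /= perm_cons perm_sym.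
have sub1 : subseq (t1 ++ t2) (t1 ++ y :: t2) by rewrite cat_subseq // subseq_cons.
have mem_s z : z \in t1 -> z \in s by move=> zt; rewrite (perm_mem pst') mem_cat zt.
have Pf' w z : z \in s -> P w -> P (f w z) by move=> zs; apply: Pf; rewrite inE zs orbT.
have C' y' z' : subseq [:: y'; z'] s -> subseq [:: z'; y'] (t1 ++ t2) ->
    forall w, P w -> f (f w y') z' = f (f w z') y'.
  move=> h1 h2; apply: C; last exact: subseq_trans h2 sub1.
  exact: subseq_trans h1 (subseq_cons _ _).
rewrite /= (IHs _ Pf' us pst' C'); last by apply: Pf; rewrite ?mem_head.
have Cy z w : z \in t1 -> P w -> f (f w y) z = f (f w z) y.
  move=> zt Pw; apply: C => //; first by rewrite /= eqxx sub1seq mem_s.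
  rewrite -[[:: z; y]]/([:: z] ++ [:: y]) cat_subseq ?sub1seq //; exact: mem_head.
have {}Pf w z : z \in t1 -> P w -> P (f w z) by move=> zt; apply: Pf'; apply: mem_s.
rewrite !foldl_cat /=; congr foldl.
elim: (t1) Cy Pf x Px => //= z t1' IHt Cy Pf w Pw.
rewrite Cy ?mem_head // IHt //; first 1 last.
- by move=> *; apply: Pf => //; rewrite inE; apply/orP; right.
- exact: Pf (mem_head _ _) Pw.
by move=> *; apply: Cy => //; rewrite inE; apply/orP; right.
Qed.

(** On the diagonal r + c = n both s_(n-1) and s_n act at place n - 2, and only s_n changes
    signs. *)
Definition box_step (n : nat) (u : seq int) (rc : nat * nat) : seq int :=
  sort_step (rc.1 + rc.2).-2 ((rc.1 + rc.2 == n)%N && odd (n - rc.1)) u.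

(** For m = n - 1 this runs through Q from the bottom row up, a linear extension along which the
    sort proceeds by passes. *)
Fixpoint rows (n m : nat) : seq (nat * nat) :=
  if m is m'.+1 then rows n m' ++ [seq ((n - m)%N, c) | c <- iota 1 m] else [::].

Lemma rowsS n m :
  rows n m.+1 = rows n m ++ [seq ((n - m.+1)%N, c) | c <- iota 1 m.+1].
Proof. by []. Qed.

(** Each row is one pass, over one more entry than the row before. For m = 0 the correction cancels
    the change of sign that [carry] makes on a single entry. *)
Lemma foldl_rows n m u : size u = n -> (m < n)%N ->
  foldl (box_step n) u (rows n m) =
  take (n - m.+1)%N u ++ negate_last (~~ odd m) (carry_sort (drop (n - m.+1)%N u)).
Proof.
move=> un; elim: m => [|m IHm] mn.
  rewrite /= subn1; case/lastP: u un => [|u x]; first by move=> E; rewrite -E in mn.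
  rewrite size_rcons => <-; rewrite -cats1 take_size_cat // drop_size_cat //=.
  by rewrite opprK.
rewrite rowsS foldl_cat IHm ?(ltnW mn) //; set k := (n - m.+2)%N.
have -> : (n - m.+1 = k.+1)%N by rewrite /k; lia.
have ku : (k < size u)%N by rewrite un /k; lia.
rewrite (take_nth 0 ku) cat_rcons; set x := nth 0 u k.
set s := carry_sort (drop k.+1 u).
have sm : size s = m.+1 by rewrite size_carry_sort size_drop un /k; lia.
have pk : size (take k u) = k by rewrite size_take ku.
have := @sort_row (~~ odd m) (take k u) x s; rewrite pk sm.
have s0 : s != [::] by rewrite -size_eq0 sm.
(* Row k + 1 starts at place k, its box in column c acting at place k + c - 1. *)
move=> /(_ s0) R; rewrite foldl_mapE; have E : iota k m.+1 = [seq (k.+1 + c).-2 | c <- iota 1 m.+1].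
  rewrite -[k in LHS](addn0 k) iotaDl -[1%N]addn0 iotaDl -map_comp.
  by apply: eq_map => c /=; rewrite add1n addnS.
rewrite E foldl_mapE in R.
rewrite [drop k u](drop_nth 0 ku) -/x /carry_sort [foldr _ _ _]/= -/(carry_sort _) -/s.
rewrite negbK in R *; rewrite -R.
apply: eq_in_foldl => y c; rewrite mem_iota => cm; rewrite /box_step /=.
congr (sort_step _ _ _); rewrite andbC; congr (_ && _); last first.
  by apply/eqP/eqP; rewrite /k in cm *; lia.
by rewrite (_ : n - k.+1 = m.+1)%N //; rewrite /k; lia.
Qed.

(** The doubtful sign is harmless, as the last entry of [down n] is 0. *)
Lemma box_sort_down n u : size u = n -> (0 < n)%N ->
  (foldl (box_step n) u (rows n n.-1) == down n) = (carry_sort u == down n).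
Proof.
move=> un n0; rewrite foldl_rows //; last by rewrite prednK.
rewrite prednK // subnn take0 drop0 cat0s.
case: n n0 un => // n _ _; apply/eqP/eqP => [E|->]; last exact: negate_last_down.
by rewrite -[carry_sort u](negate_lastK (~~ odd n)) E negate_last_down.
Qed.

(** * Length and ascents in the Weyl group *)

(** The number of positive roots made negative in type D: the two counts correspond to the roots e_i
    - e_j and e_i + e_j. *)
Fixpoint inversions (u : seq int) : nat :=
  if u is x :: s then
    (count (fun y => x < y)%R s + count (fun y => x + y < 0)%R s + inversions s)%N
  else 0.

(** Exactly one of the two comparisons within the exchanged pair changes. When signs change the pair
    is last, so all other entries stand before it. *)
Lemma inversions_act n k (e : bool) u : (k.+1 < n)%N -> (e -> k.+2 = n) -> signed_word n u ->
  (inversions (act k e u) + ~~ asc k e u = inversions u + asc k e u)%N.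
Proof.
move=> kn ek un; have [/eqP us _ _] := and3P un.
have [|p [a [b [q [uE pk]]]]] := @split2 u k; first by rewrite us.
have q0 : e -> q = [::].
  move=> /ek; rewrite -pk -us uE size_cat /= => h.
  by apply: size0nil; move: h; clear; lia.
rewrite uE in un *; rewrite actE // ascE //.
have ab := signed_word_neq e un.
have ab' := signed_word_neq (~~ e) un.
(* A plain exchange preserves both counts against an earlier entry; with changes of sign the two
   counts are interchanged. *)
have cnt x r : ((count (fun y => x < y)%R (r ++ [:: flip e b, flip e a & q])
                + count (fun y => x + y < 0)%R (r ++ [:: flip e b, flip e a & q])) =
               (count (fun y => x < y)%R (r ++ [:: a, b & q])
                + count (fun y => x + y < 0)%R (r ++ [:: a, b & q])))%N.
  rewrite !count_cat /=.
  case: (e) q0 => [/(_ isT) ->|_] /=; last by lia.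
  have -> : (x < - b) = (x + b < 0) by lia.
  have -> : (x < - a) = (x + a < 0) by lia.
  have -> : (x - b < 0) = (x < b) by lia.
  have -> : (x - a < 0) = (x < a) by lia.
  lia.
elim: p {uE pk un} => [|x p IHp] /=; last by rewrite cnt -!addnA IHp.
move: ab ab'; case: (e) q0 => [/(_ isT) ->|_] /= ab ab'.
  by move: (a) (b) ab ab' => x y; lia.
have -> : (b + a < 0) = (a + b < 0) by rewrite addrC.
by case: (ltP b a) => h; case: (ltP a b) => h'; lia.
Qed.

Lemma signed_word_down m : signed_word m (down m).
Proof.
have mem_down k x : x \in down k -> exists2 j, (j < k)%N & x = j%:Z.
  elim: k => //= k IHk; rewrite inE => /predU1P[->|/IHk[j jk ->]]; first by exists k.
  by exists j => //; apply: leqW.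
apply/and3P; split; first by rewrite size_down.
  elim: m => //= m ->; rewrite andbT; apply/mapP=> -[x /mem_down[j jm ->]] /=; lia.
by apply/allP=> x /mem_down[j jm ->].
Qed.

Lemma inversions_down m : inversions (down m) = 0%N.
Proof.
have ge0 k x : x \in down k -> 0 <= x < k%:Z.
  elim: k => //= k IHk; rewrite inE => /predU1P[->|/IHk]; lia.
elim: m => //= m ->; rewrite addn0.
rewrite !(eq_in_count (a2 := pred0)) ?count_pred0 // => x /ge0 hx; apply/negbTE; lia.
Qed.

Section Weyl.

Variable n : nat.
Hypothesis n_gt1 : (1 < n)%N.

Local Notation signed := (signed n).
Local Notation e_ := (unit_vec n).

Definition simple_pos (i : nat) : nat := if (i < n)%N then i.-1 else n.-2.

Lemma simple_pos_lt i : (0 < i <= n)%N -> ((simple_pos i).+1 < n)%N.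
Proof. by rewrite /simple_pos; case: (ltnP i n); lia. Qed.

Definition neg_if (e : bool) (x : signed) : signed := if e then negv x else x.

Lemma simpleE i : (0 < i <= n)%N ->
  simple n i = root_reflection (e_ (simple_pos i).+1) (neg_if (n <= i)%N (e_ (simple_pos i).+2)).
Proof.
move=> /andP[i0 i_n]; rewrite /simple /simple_pos; case: ltnP => h /=.
  by rewrite prednK.
by congr (root_reflection (e_ _) (negv (e_ _))); lia.
Qed.

Lemma unit_vec_eq1 i j : (i <= n)%N -> (j <= n)%N -> ((e_ i).1 == (e_ j).1) = (i == j).
Proof. by move=> i_n j_n; rewrite -val_eqE /= !inordK. Qed.

Lemma neg_if1 e x : (neg_if e x).1 = x.1.
Proof. by case: e. Qed.

Lemma simple_neq i : (0 < i <= n)%N ->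
  (e_ (simple_pos i).+1).1 != (neg_if (n <= i)%N (e_ (simple_pos i).+2)).1.
Proof.
move=> hi; rewrite neg_if1 unit_vec_eq1 ?ltn_eqF //; first exact: ltnW (simple_pos_lt hi).
exact: simple_pos_lt.
Qed.

Lemma simples_memP s :
  reflect (exists2 i, (0 < i <= n)%N & s = simple n i) (s \in simples n).
Proof.
apply: (iffP imsetP) => [[i _ ->]|[[|i] // i_n ->]]; first by exists i.+1; rewrite //= ltn_ord.
by exists (Ordinal (i_n : i < n)%N).
Qed.

Lemma weylD_ind (P : {perm signed} -> Prop) : P 1%g ->
    (forall v i, v \in weylD n -> P v -> (0 < i <= n)%N -> P (v * simple n i)%g) ->
  forall v, v \in weylD n -> P v.
Proof.
move=> P1 Pm v /gen_prodgP[k [c cS ->]].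
suff: (\prod_(i < k) c i)%g \in weylD n /\ P (\prod_(i < k) c i)%g by case.
elim: k c cS => [|k IHk] c cS; first by rewrite big_ord0 group1.
rewrite big_ord_recr /=.
have [IH1 IH2] := IHk (fun i => c (widen_ord (leqnSn k) i)) (fun i => cS _).
have /simples_memP[i i_n E] := cS ord_max.
split; last by rewrite E; apply: Pm.
by rewrite groupM // mem_gen.
Qed.

Lemma simple_weylD i : (0 < i <= n)%N -> simple n i \in weylD n.
Proof. by move=> hi; apply: mem_gen; apply/simples_memP; exists i. Qed.

Lemma simple_invol i : (0 < i <= n)%N -> (simple n i * simple n i = 1)%g.
Proof. by move=> hi; rewrite simpleE // root_reflection2 // simple_neq. Qed.

Lemma simpleV i : (0 < i <= n)%N -> ((simple n i)^-1 = simple n i)%g.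
Proof. by move=> hi; apply/eqP; rewrite eq_invg_mul simple_invol. Qed.

Lemma weylD_negv v x : v \in weylD n -> v (negv x) = negv (v x).
Proof.
move=> vW; move: v vW x; apply: weylD_ind => [x|v i _ IHv hi x]; first by rewrite !perm1.
by rewrite !permM IHv simpleE // root_reflection_negv ?simple_neq.
Qed.

Lemma weylD_fix0 v c : v \in weylD n -> v (ord0, c) = (ord0, c).
Proof.
move=> vW; move: v vW; apply: weylD_ind => [|v i _ IHv hi]; first by rewrite perm1.
have hk := simple_pos_lt hi.
rewrite permM IHv simpleE // root_reflectionE ?simple_neq // neg_if1 /=.
by rewrite -!val_eqE /= !inordK // ltnW.
Qed.

(** Each simple reflection is a product of two transpositions of signed vectors, whereas a single
    change of sign is one transposition. *)
Lemma weylD_even v : v \in weylD n -> odd_perm v = false.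
Proof.
move: v; apply: weylD_ind => [|v i _ IHv hi]; first by rewrite odd_perm1.
rewrite odd_permM IHv simpleE // /root_reflection odd_permM !odd_tperm.
have := simple_neq hi; set x := e_ _; set y := neg_if _ _ => xy.
have -> : (negv x == negv y) = (x == y).
  by case: (x) (y) => [a b] [c d]; rewrite !xpair_eqE /= (inj_eq negb_inj).
by rewrite addbb.
Qed.

Definition value (x : signed) : int := flip x.2 (n - x.1)%N%:Z.

Lemma value_negv x : value (negv x) = - value x.
Proof. by case: x => a [] //=; rewrite /value /= ?opprK. Qed.

Lemma value_neg_if e x : value (neg_if e x) = flip e (value x).
Proof. by case: e => //=; rewrite value_negv. Qed.

(* The sign of [e_n] is lost: [value] maps both [e_n] and [- e_n] to [0]. *)
Definition word (v : {perm signed}) : seq int := [seq value ((v^-1)%g (e_ i)) | i <- iota 1 n].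

Lemma word1 : word 1 = down n.
Proof.
apply: (@eq_from_nth _ 0); rewrite size_map size_iota ?size_down // => i i_n.
rewrite (nth_map 0%N) ?size_iota // nth_iota // nth_down // invg1 perm1.
by rewrite /value /= inordK //; congr Posz; lia.
Qed.

Lemma weylDV_negv v x : v \in weylD n -> (v^-1)%g (negv x) = negv ((v^-1)%g x).
Proof. by move=> vW; apply: weylD_negv; rewrite groupV. Qed.

(** The inverse in [word] turns right multiplication into an action on places: the inverse of v s
    sends x to v^-1 (s x). *)
Lemma word_simple v i : v \in weylD n -> (0 < i <= n)%N ->
  word (v * simple n i) = act (simple_pos i) (n <= i)%N (word v).
Proof.
move=> vW hi; have hk := simple_pos_lt hi; have nq := simple_neq hi.
rewrite /word; set k := simple_pos i in hk nq *; set e := (n <= i)%N in nq *.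
have -> : iota 1 n = iota 1 k ++ [:: k.+1, k.+2 & iota k.+3 (n - k.+2)].
  rewrite -[[:: _, _ & _]]/(iota k.+1 (n - k.+2).+2) -add1n -iotaD.
  by congr iota; lia.
have E x : ((v * simple n i)^-1)%g x = (v^-1)%g (simple n i x).
  by rewrite invMg permM simpleV.
rewrite !map_cat /= actE ?size_map ?size_iota //.
have fixj j : (j <= n)%N -> j != k.+1 -> j != k.+2 -> simple n i (e_ j) = e_ j.
  move=> jn j1 j2; rewrite simpleE // root_reflectionE // neg_if1.
  by rewrite !unit_vec_eq1 ?(negPf j1) ?(negPf j2) // ltnW.
congr (_ ++ _ :: _ :: _).
- by apply/eq_in_map => j; rewrite mem_iota => jk; rewrite E fixj //; lia.
- rewrite E simpleE // root_reflectionE // !eqxx -/e.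
  by rewrite -value_neg_if; case: (e) => //=; rewrite weylDV_negv.
- rewrite E simpleE // root_reflectionE // neg_if1.
  rewrite unit_vec_eq1 ?(ltnW hk) // gtn_eqF // eqxx.
  rewrite -/e -/k; case: (e) => /=; last by rewrite eqxx.
  rewrite (_ : (_ == negv _) = false) ?weylDV_negv ?value_negv //.
  by rewrite /negv xpair_eqE /= andbF.
- by apply/eq_in_map => j; rewrite mem_iota => jk; rewrite E fixj //; lia.
Qed.

Lemma signed_word_word v : v \in weylD n -> signed_word n (word v).
Proof.
move: v; apply: weylD_ind => [|v i vW IHv hi]; first by rewrite word1 signed_word_down.
by rewrite word_simple // signed_word_act // simple_pos_lt.
Qed.

Lemma inversions_word_simple v i : v \in weylD n -> (0 < i <= n)%N ->
  (inversions (word (v * simple n i)) + ~~ asc (simple_pos i) (n <= i) (word v) =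
   inversions (word v) + asc (simple_pos i) (n <= i) (word v))%N.
Proof.
move=> vW hi; rewrite word_simple //; apply: (@inversions_act n).
- exact: simple_pos_lt.
- by rewrite /simple_pos ltnNge => -> /=; move: n_gt1; clear; lia.
exact: signed_word_word.
Qed.

(* The only other candidate is the change of sign of [e_n], an odd permutation. *)
Lemma word_down v : v \in weylD n -> word v = down n -> v = 1%g.
Proof.
move=> vW wv; have vW' : (v^-1)%g \in weylD n by rewrite groupV.
have val_e j : (0 < j <= n)%N -> value ((v^-1)%g (e_ j)) = (n - j)%N%:Z.
  move=> hj; have := congr1 (fun s => nth 0 s j.-1) wv.
  rewrite (nth_map 0%N) ?size_iota ?nth_iota ?nth_down; try lia.
  by rewrite add1n prednK; [move=> ->; congr Posz|]; lia.
have nz j : (0 < j <= n)%N -> ((v^-1)%g (e_ j)).1 != ord0.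
  move=> hj; apply/eqP=> E; set c := ((v^-1)%g (e_ j)).2.
  have /perm_inj F : (v^-1)%g (ord0, c) = (v^-1)%g (e_ j).
    by rewrite weylD_fix0 // -E /c -surjective_pairing.
  by move: (congr1 (fun x : signed => val x.1) F); rewrite /= inordK; lia.
have fst_e j : (0 < j <= n)%N -> (v^-1)%g (e_ j) = neg_if ((v^-1)%g (e_ j)).2 (e_ j).
  move=> hj; have := nz j hj; have := val_e j hj.
  case: ((v^-1)%g (e_ j)) => [a c]; rewrite /value /= -val_eqE /= => h a0.
  have /eqP : (n - a = n - j)%N by move: (congr1 absz h); rewrite absz_flip.
  have an : (a <= n)%N by rewrite -ltnS ltn_ord.
  move=> aj; have -> : a = inord j by apply: val_inj; rewrite /= inordK; lia.
  by case: c {h}.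
(* For j < n the value n - j is nonzero and determines the sign. *)
have fix_lt j : (0 < j < n)%N -> (v^-1)%g (e_ j) = e_ j.
  move=> hj; rewrite fst_e; last lia.
  have := val_e j; rewrite fst_e; last lia.
  case: (_.2) => //=; rewrite value_negv /value /= inordK; lia.
pose t : {perm signed} := tperm (e_ n) (negv (e_ n)).
have sig x : exists j c, (j <= n)%N /\ x = neg_if c (e_ j).
  case: x => a c; exists (val a), c; rewrite -ltnS ltn_ord; split=> //.
  by rewrite /unit_vec inord_val; case: c.
have [c0 E] : exists c0, forall x, (v^-1)%g x = (if c0 then t else 1%g) x.
  exists ((v^-1)%g (e_ n)).2 => x; have [j [c [jn ->]]] := sig x.
  have -> : (v^-1)%g (neg_if c (e_ j)) = neg_if c ((v^-1)%g (e_ j)).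
    by case: (c) => //=; rewrite weylDV_negv.
  have tfix : j != n -> t (neg_if c (e_ j)) = neg_if c (e_ j).
    move=> j_n; have nj : (e_ n).1 != (e_ j).1 by rewrite unit_vec_eq1 // eq_sym.
    by rewrite tpermD // (contraNneq _ nj) // => /(congr1 fst); rewrite neg_if1 => <-.
  have [j0|j0] := posnP j.
    rewrite j0 in tfix *.
    rewrite (_ : (v^-1)%g (e_ 0) = e_ 0); last first.
      by rewrite /unit_vec (_ : inord 0 = ord0) ?weylD_fix0 //; apply: val_inj; rewrite /= inordK.
    by case: ifP => _; rewrite ?perm1 ?tfix // ltn_eqF // ltnW.
  have [->|j_n] := eqVneq j n.
    rewrite fst_e ?leqnn ?(ltnW n_gt1) //; case: (_.2) => /=; last by rewrite perm1.
    case: (c) => /=; last by rewrite tpermL.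
    by rewrite tpermR.
  rewrite fix_lt; last by rewrite j0 ltn_neqAle j_n.
  by case: ifP => _; rewrite ?perm1 ?tfix.
apply: invg_inj; rewrite invg1; apply/permP=> x; rewrite E; case: c0 E => // E.
have : odd_perm (v^-1)%g = false by apply: weylD_even.
have -> : (v^-1)%g = t by apply/permP=> y; rewrite E.
by rewrite odd_tperm /negv xpair_eqE /= andbF.
Qed.

(** The entries decrease and the last but one exceeds the last in absolute value, hence the first n
    - 1 are positive. Decreasing and below n, they are n - 1, ..., 1, and the last is 0. *)
Lemma all_asc_down u : signed_word n u ->
  (forall i, (0 < i <= n)%N -> asc (simple_pos i) (n <= i)%N u) -> u = down n.
Proof.
move=> /and3P[/eqP us _ /allP uA] uasc.
have dec k : (k.+1 < n)%N -> nth 0 u k.+1 < nth 0 u k.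
  move=> kn; have := uasc k.+1 (ltnW kn); rewrite /simple_pos kn.
  by rewrite leqNgt kn asc_nth ?us.
have last2 : - nth 0 u n.-1 < nth 0 u n.-2.
  have := uasc n; rewrite /simple_pos ltnn leqnn (ltnW n_gt1) => /(_ isT).
  have E : n.-2.+1 = n.-1 by move: n_gt1; clear; lia.
  by rewrite asc_nth E // us prednK // ltnW.
have bound k : (k < n)%N -> (absz (nth 0%R u k) < n)%N.
  by move=> kn; apply: uA; rewrite mem_nth ?us.
have hi k : (k < n)%N -> nth 0 u k <= (n.-1 - k)%N%:Z.
  elim: k => [|k IHk] kn; first by have := bound 0%N kn; lia.
  by have := dec k kn; have := IHk (ltnW kn); lia.
have pos : 0 < nth 0 u n.-2.
  have := dec n.-2; rewrite (_ : n.-2.+1 = n.-1); last by lia.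
  by move=> /(_ ltac:(lia)); lia.
have lo m : (m < n.-1)%N -> m.+1%:Z <= nth 0 u (n.-2 - m)%N.
  elim: m => [|m IHm] mn; first by rewrite subn0; lia.
  have := dec (n.-2 - m.+1)%N; rewrite (_ : (n.-2 - m.+1).+1 = n.-2 - m)%N; last by lia.
  by move=> /(_ ltac:(lia)); have := IHm (ltnW mn); lia.
apply: (@eq_from_nth _ 0); rewrite ?size_down // us => k kn; rewrite nth_down //.
have := hi k kn; have [k1|k1] := ltnP k n.-1.
  have := lo (n.-2 - k)%N; rewrite (_ : n.-2 - (n.-2 - k) = k)%N; last by lia.
  by move=> /(_ ltac:(lia)); lia.
have -> : k = n.-1 by lia.
have := hi n.-2; lia.
Qed.

Lemma all_asc_word v : v \in weylD n ->
  (forall i, (0 < i <= n)%N -> asc (simple_pos i) (n <= i)%N (word v)) -> v = 1%g.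
Proof. by move=> vW va; apply: word_down => //; apply: all_asc_down => //; apply: signed_word_word. Qed.

Lemma has_wordP v k :
  reflect (exists s, [/\ size s = k, all (mem (simples n)) s & v = (\prod_(x <- s) x)%g])
          (has_word (simples n) v k).
Proof.
apply: (iffP existsP) => [[t /andP[tS /eqP ->]]|[s [/eqP sk sS ->]]].
  by exists t; rewrite size_tuple.
by exists (Tuple sk); rewrite sS /=.
Qed.

(** Each factor changes the number of inversions by one, starting from 0. *)
Lemma has_word_inversions v k : has_word (simples n) v k -> (inversions (word v) <= k)%N.
Proof.
case/has_wordP=> s [<- sS ->] {v k}.
suff: (\prod_(x <- s) x)%g \in weylD n /\
      (inversions (word (\prod_(x <- s) x)%g) <= size s)%N by case.
elim/last_ind: s sS => [|s x IHs]; first by rewrite big_nil word1 inversions_down group1.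
rewrite all_rcons => /andP[/simples_memP[i hi ->] /IHs[sW sI]].
rewrite big_rcons /= size_rcons groupM ?simple_weylD //; split=> //.
have := inversions_word_simple sW hi; case: asc; rewrite /= ?addn0 ?addn1 => E.
  by rewrite E ltnS.
by rewrite (leq_trans (leqnSn _)) // E leqW.
Qed.

(** As long as there is a descent, multiplying by it removes an inversion; without descents the
    element is 1. *)
Lemma inversions_has_word v : v \in weylD n ->
  exists2 k, (k <= inversions (word v))%N & has_word (simples n) v k.
Proof.
move: {2}(inversions _) (leqnn (inversions (word v))) => m.
elim: m v => [|m IHm] v vm vW.
  suff -> : v = 1%g by exists 0%N => //; apply/has_wordP; exists [::]; rewrite big_nil.
  apply: all_asc_word => // i hi; have := inversions_word_simple vW hi.
  by case: asc => //=; lia.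
case: (boolP [forall i : 'I_n, asc (simple_pos i.+1) (n <= i.+1)%N (word v)]).
  move/forallP=> va; suff -> : v = 1%g.
    by exists 0%N => //; apply/has_wordP; exists [::]; rewrite big_nil.
  by apply: all_asc_word => // -[//|i] hi; apply: (va (Ordinal (hi : i < n)%N)).
case/forallPn=> i ni; have hi : (0 < i.+1 <= n)%N by rewrite /= ltn_ord.
have := inversions_word_simple vW hi; rewrite (negPf ni) /= addn0 addn1 => E.
have [||k km] := IHm (v * simple n i.+1)%g.
- by rewrite -ltnS E.
- by rewrite groupM ?simple_weylD.
case/has_wordP=> s [sk sS sE]; exists k.+1; first by rewrite -E ltnS.
apply/has_wordP; exists (rcons s (simple n i.+1)); split; first by rewrite size_rcons sk.
  by rewrite all_rcons sS andbT; apply/simples_memP; exists i.+1.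
by rewrite big_rcons /= -sE -mulgA simple_invol // mulg1.
Qed.

Lemma coxeter_length_inversions v : v \in weylD n ->
  coxeter_length (simples n) v = inversions (word v).
Proof.
move=> vW; rewrite /coxeter_length; case: {-}_ / idP => // Sw.
case: ex_minnP => m mw mmin; apply/eqP; rewrite eqn_leq has_word_inversions // andbT.
by have [k kI /mmin mk] := inversions_has_word vW; apply: leq_trans kI.
Qed.

Lemma bruhat_connect_length u v : connect (bruhat_step (simples n)) u v ->
  (coxeter_length (simples n) u <= coxeter_length (simples n) v)%N.
Proof.
case/connectP=> p; elim: p u => [|w p IHp] u /= => [_ -> //|/andP[/andP[_ uw] wp] vE].
exact: leq_trans (ltnW uw) (IHp _ wp vE).
Qed.

(** The two elements differ by a reflection, so they are comparable in the direction given by the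
    length, which increases along every Bruhat step. *)
Lemma bruhat_lt_simple v i : v \in weylD n -> (0 < i <= n)%N ->
  bruhat_lt (simples n) v (v * simple n i)%g = asc (simple_pos i) (n <= i)%N (word v).
Proof.
move=> vW hi; have vsW : (v * simple n i)%g \in weylD n by rewrite groupM ?simple_weylD.
have := inversions_word_simple vW hi.
rewrite -!coxeter_length_inversions //; case: asc => /= E.
  have lt : (coxeter_length (simples n) v < coxeter_length (simples n) (v * simple n i)%g)%N.
    by lia.
  rewrite /bruhat_lt /=; apply/andP; split.
    by apply: contraTneq lt => <-; rewrite ltnn.
  apply: connect1; rewrite /bruhat_step /= lt andbT mulKg.
  rewrite -[simple n i]conjg1; apply: memJ_class_support; last exact: group1.
  by apply/simples_memP; exists i.
apply/negbTE/negP => /andP[_ /bruhat_connect_length]; lia.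
Qed.

End Weyl.

(** * Gamma-diagrams *)

Definition row_before (x y : nat * nat) : bool :=
  (y.1 < x.1)%N || (y.1 == x.1) && (x.2 < y.2)%N.

Lemma mem_rows n m x : (m <= n)%N ->
  (x \in rows n m) = (n - m <= x.1 < n)%N && (0 < x.2 <= n - x.1)%N.
Proof.
elim: m => [|m IHm] mn; first by rewrite subn0 in_nil; apply/esym/negbTE; lia.
rewrite rowsS mem_cat IHm ?(ltnW mn) //.
have -> : (x \in [seq ((n - m.+1)%N, c) | c <- iota 1 m.+1]) =
          (x.1 == n - m.+1)%N && (0 < x.2 <= m.+1)%N.
  apply/mapP/andP => [[c + ->]|[/eqP x1 x2]].
    by rewrite mem_iota add1n ltnS.
  by exists x.2; rewrite ?mem_iota ?add1n // -x1 -surjective_pairing.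
by move: (x.1) (x.2) mn => r c; clear; lia.
Qed.

Lemma rows_pairwise n m : (m <= n)%N -> pairwise row_before (rows n m).
Proof.
elim: m => // m IHm mn; rewrite rowsS pairwise_cat; apply/and3P; split; last 1 first.
- rewrite pairwise_map; apply: (sub_pairwise (r := ltn)) => [c c' cc'|].
    by rewrite /= /row_before /= eqxx; apply/orP; right.
  by rewrite -sorted_pairwise ?iota_ltn_sorted //; apply: ltn_trans.
- apply/allrelP=> x y xr /mapP[c cm ->]; move: xr; rewrite mem_rows ?(ltnW mn) //.
  by rewrite /row_before /=; lia.
- exact/IHm/ltnW.
Qed.

Section Boxes.

Variable n : nat.
Hypothesis n_gt1 : (1 < n)%N.

Definition coord (x : box n) : nat * nat := (box_row x, box_col x).

Lemma coord_bounds (x : box n) :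
  [/\ (0 < box_row x)%N, (0 < box_col x)%N & (box_row x + box_col x <= n)%N].
Proof. exact/and3P/(valP x). Qed.

Lemma coord_inj : injective coord.
Proof.
move=> x y [rr cc]; apply: val_inj; case: x y rr cc => [[r c] ?] [[r' c'] ?] /=.
by rewrite /box_row /box_col /= => /val_inj -> /val_inj ->.
Qed.

Lemma coord_surj r c : (0 < r)%N -> (0 < c)%N -> (r + c <= n)%N ->
  exists x : box n, box_row x = r /\ box_col x = c.
Proof.
move=> r0 c0 rc; have rn : (r < n)%N by lia.
have cn : (c < n)%N by lia.
have h : [&& 0 < (Ordinal rn : nat), 0 < (Ordinal cn : nat) & Ordinal rn + Ordinal cn <= n]%N.
  by rewrite /= r0 c0.
by exists (exist _ (Ordinal rn, Ordinal cn) h).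
Qed.

(** Go up to the row of [y] and then right: this path stays inside the staircase. *)
Lemma box_le_coord (x y : box n) :
  (box_row y <= box_row x)%N -> (box_col x <= box_col y)%N -> box_le x y.
Proof.
move: {2}(box_row x - box_row y + (box_col y - box_col x))%N (leqnn (box_row x - box_row y + (box_col y - box_col x))%N) => d.
have [y1 y2 y3] := coord_bounds y.
elim: d x => [|d IHd] x xd hr hc.
  suff -> : x = y by apply: connect0.
  by apply: coord_inj; rewrite /coord; congr pair; lia.
have [x1 x2 x3] := coord_bounds x.
have [rr|rr] := ltnP (box_row y) (box_row x).
  have [||| z [zr zc]] := @coord_surj (box_row x).-1 (box_col x); try lia.
  apply: (@connect_trans _ _ z); last by apply: IHd; lia.
  by apply: connect1; rewrite /box_cover /= zr zc eqxx prednK // eqxx orbT.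
have [cc|cc] := ltnP (box_col x) (box_col y).
  have [||| z [zr zc]] := @coord_surj (box_row x) (box_col x).+1; try lia.
  apply: (@connect_trans _ _ z); last by apply: IHd; lia.
  by apply: connect1; rewrite /box_cover /= zr zc !eqxx.
by apply: IHd; lia.
Qed.

Definition box_sort (x : box n) (u : seq int) : seq int :=
  sort_step (simple_pos n (label x)) (n <= label x)%N u.

Definition box_asc (x : box n) (u : seq int) : bool :=
  asc (simple_pos n (label x)) (n <= label x)%N u.

Definition box_act (x : box n) (u : seq int) : seq int :=
  act (simple_pos n (label x)) (n <= label x)%N u.

Lemma box_sortE x u : box_sort x u = box_step n u (coord x).
Proof.
have [x1 x2 x3] := coord_bounds x; rewrite /box_sort /box_step /coord /simple_pos /label /=.
case: (ltnP (box_row x + box_col x) n) => h.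
  have h1 : ((box_row x + box_col x).-1 < n)%N by apply: leq_ltn_trans (leq_pred _) h.
  by rewrite h1 leqNgt h1 (ltn_eqF h).
have -> : (box_row x + box_col x = n)%N by apply/eqP; rewrite eqn_leq x3.
rewrite eqxx /=; case: odd; first by rewrite ltnn leqnn.
have n1 : (n.-1 < n)%N by rewrite prednK // ltnW.
by rewrite n1 leqNgt n1.
Qed.

Lemma box_pos_lt (x : box n) : ((simple_pos n (label x)).+1 < n)%N.
Proof. by apply: simple_pos_lt => //; apply: label_bounds. Qed.

Lemma signed_word_box_act x u : signed_word n u -> signed_word n (box_act x u).
Proof. exact: signed_word_act (box_pos_lt x). Qed.

Lemma box_actK x u : signed_word n u -> box_act x (box_act x u) = u.
Proof. by case/and3P=> /eqP us _ _; apply: actK; rewrite us box_pos_lt. Qed.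

Lemma box_asc_act x u : signed_word n u -> box_asc x (box_act x u) = ~~ box_asc x u.
Proof. exact: asc_act (box_pos_lt x). Qed.

Variable b : seq (box n).
Hypothesis hb : linear_extension b.

Lemma linear_extension_uniq : uniq b.
Proof. by case/andP: hb => /perm_uniq -> _; apply: enum_uniq. Qed.

Lemma linear_extension_mem x : x \in b.
Proof. by case/andP: hb => /perm_mem -> _; rewrite mem_enum. Qed.

Lemma linear_extension_pairwise :
  pairwise (fun x y => ~~ ((x.1 <= y.1)%N && (y.2 <= x.2)%N)) (map coord b).
Proof.
rewrite pairwise_map; case Eb: b => [//|x0 b']; rewrite -Eb; apply/(pairwiseP x0).
move=> i j ib jb ij /=; apply/negP=> /andP[h1 h2].
have := box_le_coord h1 h2; case/andP: hb => _ /forallP/(_ (nth x0 b j)).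
move=> /forallP/(_ (nth x0 b i))/implyP le /le.
by rewrite !index_uniq ?linear_extension_uniq // leqNgt ij.
Qed.

Lemma perm_coord_rows : perm_eq (map coord b) (rows n n.-1).
Proof.
apply: uniq_perm.
- by rewrite (map_inj_uniq coord_inj) linear_extension_uniq.
- have := @rows_pairwise n n.-1 (leq_pred n); rewrite uniq_pairwise.
  apply: sub_pairwise => x y; apply: contraTneq => <-.
  by rewrite /row_before ltnn eqxx ltnn.
move=> [r c]; rewrite mem_rows ?leq_pred //=; apply/mapP/idP => [[x _ [-> ->]]|rc].
  by have [] := coord_bounds x; move: n_gt1; clear; lia.
have [||| x [xr xc]] := @coord_surj r c; try by move: n_gt1 rc; clear; lia.
by exists x; rewrite ?linear_extension_mem // /coord xr xc.
Qed.

(** Boxes in opposite orders in two linear extensions are incomparable, and their steps then act on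
    disjoint pairs of places, so [foldl_perm] applies. *)
Lemma foldr_box_sort u : signed_word n u ->
  foldr box_sort u (rev b) = foldl (box_step n) u (rows n n.-1).
Proof.
move=> un; rewrite -foldl_rev revK.
have -> : foldl (fun z x => box_sort x z) u b = foldl (box_step n) u (map coord b).
  by rewrite foldl_mapE; apply: eq_in_foldl => y x _; rewrite box_sortE.
apply: (@foldl_perm _ _ (signed_word n)) => //.
- move=> w _ /mapP[x _ ->] wn; rewrite -box_sortE.
  exact: signed_word_sort_step (box_pos_lt x) wn.
- by rewrite (map_inj_uniq coord_inj) linear_extension_uniq.
- exact: perm_coord_rows.
move=> [ry cy] [rz cz] yz zy w wn.
have /= /andP[/andP[yz' _] _] := subseq_pairwise yz linear_extension_pairwise.
have /= /andP[/andP[zy' _] _] := subseq_pairwise zy (rows_pairwise (leq_pred n)).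
have bnd p : p \in map coord b -> [/\ 0 < p.1, 0 < p.2 & p.1 + p.2 <= n]%N.
  by case/mapP=> x _ ->; apply: coord_bounds.
have /= [y1 y2 y3] := bnd (ry, cy) (mem_subseq yz (mem_head _ _)).
have /= [z1 z2 z3] := bnd (rz, cz) (mem_subseq yz (mem_last (ry, cy) [:: (rz, cz)])).
have wsz : size w = n by case/and3P: wn => /eqP.
(* The second box lies strictly lower and strictly further right than the first, so r + c differs by
   at least 2. *)
have h1 : ((ry + cy).-2.+1 < (rz + cz).-2)%N.
  by move: yz' zy' y1 y2 z1 z2; rewrite /row_before /=; clear; lia.
have h2 : ((rz + cz).-2.+1 < size w)%N by rewrite wsz; move: z1 z2 z3; clear; lia.
by rewrite /box_step (sort_stepC _ _ h1 h2).
Qed.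

Lemma foldr_box_sort_down u :
  signed_word n u && (foldr box_sort u (rev b) == down n) = (u \in primitives low_words odd_cut n).
Proof.
rewrite mem_filter mem_low_words; case un: (signed_word n u); last by rewrite andbF.
have us : size u = n by case/and3P: un => /eqP.
rewrite foldr_box_sort // box_sort_down ?(ltnW n_gt1) //.
by rewrite (carry_sort_down un (ltnW n_gt1)) /= andbC.
Qed.

(** * Diagrams as sequences of ascents *)

Implicit Types (D : diagram n) (l : seq (box n)).

Definition box_move D (u : seq int) (x : box n) : seq int := if D x then u else box_act x u.

(** The Gamma condition expressed on words ([is_gammaE]). *)
Fixpoint ascending D l (u : seq int) : bool :=
  if l is x :: l' then box_asc x u && ascending D l' (box_move D u x) else true.

Lemma signed_word_box_move D x u : signed_word n u -> signed_word n (box_move D u x).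
Proof. by rewrite /box_move; case: (D x) => // /signed_word_box_act. Qed.

Lemma signed_word_box_moves D l u : signed_word n u ->
  signed_word n (foldl (box_move D) u l).
Proof. by elim: l u => //= x l IHl u un; apply/IHl/signed_word_box_move. Qed.

Lemma ascending_sort D l u : signed_word n u -> ascending D l u ->
  foldr box_sort (foldl (box_move D) u l) l = u.
Proof.
elim: l u => //= x l IHl u un /andP[xu ul].
rewrite IHl //; last exact: signed_word_box_move.
rewrite /box_sort /sort_step -/(box_asc x _) -/(box_act x _) /box_move.
by case: (D x); rewrite ?xu // box_asc_act // xu /= box_actK.
Qed.

Lemma ascending_inj D D' l u : signed_word n u -> ascending D l u -> ascending D' l u ->
  foldl (box_move D) u l = foldl (box_move D') u l -> {in l, D =1 D'}.
Proof.
elim: l u => //= x l IHl u un /andP[xu Dl] /andP[_ Dl'] E.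
have xE : box_move D u x = box_move D' u x.
  rewrite -(ascending_sort _ Dl) ?signed_word_box_move // E.
  by rewrite ascending_sort ?signed_word_box_move.
have {xE} Dx : D x = D' x.
  move/(congr1 (box_asc x)): xE.
  by rewrite /box_move; case: (D x); case: (D' x); rewrite // box_asc_act ?xu.
have Em : box_move D u x = box_move D' u x by rewrite /box_move Dx.
move=> y; rewrite inE => /predU1P[->//|]; apply: (IHl (box_move D u x)) => //.
- exact: signed_word_box_move.
- by rewrite Em.
by rewrite E Em.
Qed.

Lemma eq_in_ascending D D' l u : {in l, D =1 D'} -> ascending D l u = ascending D' l u.
Proof.
elim: l u => //= x l IHl u DD'; rewrite /box_move DD' ?mem_head // IHl // => y yl.
by rewrite DD' // inE yl orbT.
Qed.

Lemma sort_ascending l u : uniq l -> signed_word n u ->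
  exists D, ascending D l (foldr box_sort u l) /\
            foldl (box_move D) (foldr box_sort u l) l = u.
Proof.
move=> + un; elim: l => [|x l IHl] /=; first by exists [ffun=> true].
case/andP=> xl /IHl[D [Da Dm]]; set w := foldr box_sort u l in Da Dm *.
have wn : signed_word n w.
  rewrite /w; elim: (l) => //= y l' IHl'.
  exact: signed_word_sort_step (box_pos_lt y) IHl'.
(* The box gets + exactly when sorting leaves the word unchanged there. *)
pose D' : diagram n := [ffun y => if y == x then box_asc x w else D y].
have DD' : {in l, D' =1 D}.
  by move=> y yl; rewrite ffunE ifN //; apply: contraNneq xl => <-.
have E : box_move D' (box_sort x w) x = w.
  rewrite /box_move ffunE eqxx /box_sort /sort_step -/(box_asc x _) -/(box_act x _).
  by case: (box_asc x w) => //; rewrite box_actK.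
exists D'; rewrite E; split; last first.
  by rewrite -[RHS]Dm; apply: eq_in_foldl => y z /DD' yE; rewrite /box_move yE.
rewrite (eq_in_ascending _ DD') Da andbT /box_sort /sort_step -/(box_asc x _) -/(box_act x _).
by case: ifP => // wx; rewrite box_asc_act // wx.
Qed.

(** The starting element [v] is arbitrary so that the induction on [l] can absorb the first factor
    into it. *)
Lemma ascendingP D l v : v \in weylD n ->
  reflect (forall k, (k < size l)%N ->
    let p := (\prod_(t <- take k [seq if D x then 1 else simple n (label x) | x <- l]) t)%g in
    bruhat_lt (simples n) (v * p)%g (v * p * nth 1 [seq simple n (label x) | x <- l] k)%g)
  (ascending D l (word v)).
Proof.
move=> vW; apply: (iffP idP).
  elim: l v vW => // x l IHl v vW /= /andP[xv lv] [|k] /= kl.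
    by rewrite big_nil mulg1 bruhat_lt_simple // label_bounds.
  pose t := (if D x then 1 else simple n (label x))%g.
  have tW : t \in weylD n.
    by rewrite /t; case: (D x); rewrite ?group1 ?simple_weylD ?label_bounds.
  have wt : word (v * t) = box_move D (word v) x.
    by rewrite /t /box_move; case: (D x); rewrite ?mulg1 // word_simple ?label_bounds.
  by rewrite big_cons mulgA; apply: IHl; rewrite ?groupM ?wt.
elim: l v vW => // x l IHl v vW H /=.
pose t := (if D x then 1 else simple n (label x))%g.
have tW : t \in weylD n.
  by rewrite /t; case: (D x); rewrite ?group1 ?simple_weylD ?label_bounds.
have wt : word (v * t) = box_move D (word v) x.
  by rewrite /t /box_move; case: (D x); rewrite ?mulg1 // word_simple ?label_bounds.
apply/andP; split.
  by have := H 0%N isT; rewrite /= big_nil mulg1 bruhat_lt_simple // label_bounds.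
rewrite -wt; apply: IHl => [|k kl]; first by rewrite groupM.
by have := H k.+1 kl; rewrite /= big_cons mulgA.
Qed.

Lemma is_gammaE D : is_gamma b D = ascending D (rev b) (down n).
Proof.
rewrite /is_gamma -word1 //.
apply/forallP/(ascendingP D (rev b) (group1 (weylD n))) => H k.
  rewrite size_rev => kb; have := H (Ordinal kb).
  by rewrite /partial_prod /= mul1g.
by have := H k; rewrite size_rev ltn_ord /= mul1g => /(_ isT).
Qed.

(** Send a diagram to the word of its last partial product; the image consists of the words sorted
    into [down n]. *)
Lemma card_gamma_diagram :
  #|{: gamma_diagram b}| = size (primitives low_words odd_cut n).
Proof.
pose f (D : gamma_diagram b) := foldl (box_move (val D)) (down n) (rev b).
have dn := signed_word_down n.
have fP (D : gamma_diagram b) : ascending (val D) (rev b) (down n).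
  by rewrite -is_gammaE; apply: valP.
rewrite cardE -(size_map f); apply: perm_size; apply: uniq_perm.
- rewrite map_inj_uniq ?enum_uniq // => D D' E; apply/val_inj/ffunP => x.
  by apply: (ascending_inj dn (fP D) (fP D') E); rewrite mem_rev linear_extension_mem.
- by rewrite filter_uniq ?low_words_uniq.
move=> u; rewrite -foldr_box_sort_down; apply/mapP/andP => [[D _ ->]|[un /eqP uD]].
  by rewrite signed_word_box_moves // ascending_sort.
have [|D [Da Dm]] := @sort_ascending (rev b) u _ un.
  by rewrite rev_uniq linear_extension_uniq.
rewrite uD -is_gammaE in Da Dm; exists (exist _ D Da) => //.
by rewrite mem_enum.
Qed.

End Boxes.

(** * The final count *)

Lemma card_atomic n : (0 < n)%N ->
  #|{: atomic_preference_function n}| = size (primitives prefs pref_cut n).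
Proof.
move=> n0; pose f (p : atomic_preference_function n) : seq nat := val (val p).
rewrite cardE -(size_map f); apply: perm_size; apply: uniq_perm.
- by rewrite map_inj_uniq ?enum_uniq // => p p' /val_inj/val_inj.
- by rewrite filter_uniq ?prefs_uniq.
(* In the definition of atomicity r must be the largest letter of the prefix, and it is positive as
   the prefix is not empty. *)
have cutE (p : n.-tuple nat) : atomic p = all (fun c => ~~ pref_cut p c) (iota 1 n.-1).
  apply/atomicP/allP => [pA j|pA [j [r [jn r1 jr rj]]]].
    rewrite mem_iota => jn; apply/negP=> /andP[tj /allP dj]; apply: pA.
    exists j, (top (take j p)); split=> //; first by move: jn n0; clear; lia.
      have /letters_upto_size : letters_upto (take j p) (top (take j p)) by [].
      case E: (take j p) tj => [|x s] tj.
        by move/(congr1 size): E; rewrite size_take size_tuple /=; case: ltnP; lia.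
      by move=> _; have := letters_upto_mem tj x; rewrite mem_head; lia.
    exact/letters_uptoP.
  have /letters_uptoP jr' := jr.
  have ji : j \in iota 1 n.-1 by rewrite mem_iota; move: jn; clear; lia.
  move/negP: (pA j ji); apply.
  rewrite /pref_cut (top_letters_upto jr') jr' /=; exact/allP.
move=> s; rewrite mem_filter mem_prefs; apply/mapP/and3P => [[p _ ->]|[sA sn sm]].
  have /andP[/existsP[k pk] pA] := valP p.
  by rewrite -cutE size_tuple (top_letters_upto pk).
have pP : preference_function (Tuple sn) && atomic (Tuple sn).
  rewrite cutE sA andbT; apply/preference_functionP; exists (top s).
  exact/letters_uptoP.
by exists (exist _ (Tuple sn) pP); rewrite ?mem_enum.
Qed.

(** Both sides satisfy the relation of [size_gluing] with the same total numbers, counted through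
    [surjections]. *)
Lemma size_primitives n : (0 < n)%N ->
  size (primitives prefs pref_cut n) = size (primitives low_words odd_cut n).
Proof.
apply: (@convolution_inj (fun n => size (low_words n))
  (fun n => size (primitives prefs pref_cut n))
  (fun n => size (primitives low_words odd_cut n))) => // m m0.
  under eq_bigr do rewrite size_low_words -size_prefs.
  rewrite size_low_words -size_prefs.
  exact: (size_gluing prefs_uniq pref_cut0 pref_glueP pref_cutP m0).
exact: (size_gluing low_words_uniq odd_cut0 word_glueP odd_cutP m0).
Qed.

Lemma bij_of_card (T U : finType) : #|T| = #|U| -> exists f : T -> U, bijective f.
Proof.
move=> E; exists (fun x => enum_val (cast_ord E (enum_rank x))).
exists (fun y => enum_val (cast_ord (esym E) (enum_rank y))) => x.
  by rewrite enum_valK cast_ordK enum_rankK.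
by rewrite enum_valK cast_ordKV enum_rankK.
Qed.

Local Close Scope ring_scope.

Theorem mainTheorem17 (n : nat) (hn : 4 <= n)
    (b : seq (box n)) (hb : linear_extension b) :
  (exists f : atomic_preference_function n -> gamma_diagram b, bijective f)
  /\ #|{: atomic_preference_function n}| = #|{: gamma_diagram b}|.
Proof.
have n1 : 1 < n by apply: leq_trans hn.
have E : #|{: atomic_preference_function n}| = #|{: gamma_diagram b}|.
  by rewrite card_atomic ?(ltnW n1) // card_gamma_diagram // size_primitives // ltnW.
by split=> //; apply: bij_of_card.
Qed.
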